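(* Suppose $(Y_t)_{t\in\mathbb N}$ is an $\mathcal H^d$-valued martingale with $Y_0=0$ satisfying $\|\Delta Y_t\|_{\mathrm{op}}\le1$ a.s. for all $t\in\mathbb N$. Then for any $b\in[0,1]$ and $m\ge1$, $$\mathbb P(\exists t\in\mathbb N:t\ge m\text{ and }\gamma_{\max}(Y_t)\ge bt)\le d\left[(1+b)^{(1+b)}(1-b)^{(1-b)}\right]^{-m/2}.$$
   Context: $\mathcal H^d$: $d\times d$ Hermitian matrices; $\gamma_{\max}$: maximum eigenvalue; $\|\cdot\|_{\mathrm{op}}$: operator norm; $\Delta Y_t=Y_t-Y_{t-1}$; $\mathbb N=\{1,2,\dots\}$; $0^0=1$. *)

(* Defs.v *)
From mathcomp Require Export all_boot all_order all_algebra.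
From mathcomp Require Export complex.
From mathcomp Require Export all_classical all_reals all_analysis.
Export numFieldNormedType.Exports.
Export Order.TTheory GRing.Theory Num.Theory.

Set Implicit Arguments.
Unset Strict Implicit.
Unset Printing Implicit Defensive.

Local Open Scope classical_set_scope.
Local Open Scope complex_scope.
Local Open Scope ring_scope.

Definition l2norm (R : realType) (n : nat) (v : 'cV[R[i]]_n) : R :=
  Num.sqrt (\sum_(k < n) (complex.Re (v k 0) ^+ 2 + complex.Im (v k 0) ^+ 2)).

Definition opnorm (R : realType) (n : nat) (A : 'M[R[i]]_n) : R :=
  sup [set l2norm (A *m v) | v in [set v : 'cV[R[i]]_n | l2norm v <= 1]].

(* Meant for Hermitian A and 0 < n: all the eigenvalues of A are then real and
   their set is finite and nonempty, so that the supremum is a maximum. *)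
Definition gamma_max (R : realType) (n : nat) (A : 'M[R[i]]_n) : R :=
  sup [set r : R | eigenvalue A r%:C].

Definition filtration (disp : measure_display) (T : measurableType disp)
    (F : nat -> set (set T)) : Prop :=
  [/\ forall t, sigma_algebra setT (F t),
      forall t, F t `<=` measurable &
      forall s t, (s <= t)%N -> F s `<=` F t].

(* Z is a version of the conditional expectation E[X | G] *)
Definition is_cond_exp (disp : measure_display) (T : measurableType disp)
    (R : realType) (P : probability T R) (G : set (set T)) (X Z : T -> R)
    : Prop :=
  [/\ P.-integrable setT (EFin \o X),
      P.-integrable setT (EFin \o Z),
      preimage_set_system setT Z measurable `<=` G &
      forall A, G A ->
        (\int[P]_(w in A) (Z w)%:E = \int[P]_(w in A) (X w)%:E)%E].

(* For random matrices the conditional expectation is taken entrywise, on real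
   and imaginary parts. *)
Definition is_cond_exp_mx (disp : measure_display) (T : measurableType disp)
    (R : realType) (P : probability T R) (n : nat) (G : set (set T))
    (X Z : T -> 'M[R[i]]_n) : Prop :=
  forall i j : 'I_n,
    is_cond_exp P G (fun w => complex.Re (X w i j))
                    (fun w => complex.Re (Z w i j)) /\
    is_cond_exp P G (fun w => complex.Im (X w i j))
                    (fun w => complex.Im (Z w i j)).

(* E[Y_{t+1} | F_t] = Y_t a.s.; adaptedness and integrability of Y are part of
   is_cond_exp_mx. *)
Definition hermitian_martingale (disp : measure_display)
    (T : measurableType disp) (R : realType) (P : probability T R) (n : nat)
    (F : nat -> set (set T)) (Y : nat -> T -> 'M[R[i]]_n) : Prop :=
  [/\ filtration F,
      forall t w, Y t w \is hermsymmx &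
      forall t, is_cond_exp_mx P (F t) (Y t.+1) (Y t)].

(* Main.v *)
(** For [0 <= l], the trace exponential [tr exp (l Y_t)] grows in conditional
    mean by a factor at most [cosh l]. If [D] is Hermitian with [D^2 <= 1], then
    [phi s = tr exp (X + s D)] satisfies [phi'' <= phi], because in an eigenbasis
    of [X] one has [tr (D X^k D X^j) <= tr (D^2 X^(k+j))] for [X >= 0]; comparing
    with the equation [u'' = u] gives
      [tr exp (X + l D) <= cosh l * tr exp X + sinh l * tr (D exp X)],
    and the last term has conditional mean zero when [D] is a martingale
    increment. This replaces the Golden-Thompson inequality. Only partial sums of
    the exponential series are used, with [X] shifted by a multiple of the
    identity that makes it positive semidefinite up to a finite horizon; the
    truncation is removed in the maximal inequality, where it is a limit of a
    finite sum of numbers. Ville's argument then bounds the crossing probability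
    by [d * k ^ (- m)] for [k = exp (l b) / cosh l >= 1], and the theorem follows
    with [tanh l = b], or with [l] tending to infinity when [b = 1]. *)
Require Import Defs.
From mathcomp Require Import measurable_realfun ring lra.

Set Implicit Arguments.
Unset Strict Implicit.
Unset Printing Implicit Defensive.

Local Open Scope classical_set_scope.
Local Open Scope complex_scope.
Local Open Scope ring_scope.
Local Open Scope sesquilinear_scope.

(** * Positive semidefinite matrices *)

Section Psd.
Variables (C : numClosedFieldType) (d : nat).
Implicit Types (A D X : 'M[C]_d).

Definition psd A := A \is hermsymmx /\
  forall v : 'cV[C]_d, 0 <= (v^t* *m A *m v) 0 0.

Lemma hermsymmxP A : reflect (A^t* = A) (A \is hermsymmx).
Proof.
apply: (iffP (is_hermitianmxP _ _ _)); first by rewrite expr0 scale1r => {2}->.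
by rewrite expr0 scale1r => ->.
Qed.

(** Each such entry is the quadratic form of [A] at a column of the adjoint of [U]. *)
Lemma psd_conj_ge0 m (U : 'M[C]_(m, d)) A : psd A ->
  forall i, 0 <= (U *m A *m U^t*) i i.
Proof.
move=> [_ hA] i; have := hA (col i (U^t*)).
suff -> : ((col i (U^t*))^t* *m A *m col i (U^t*)) 0 0 = (U *m A *m U^t*) i i by [].
have -> : (col i (U^t*))^t* = row i U.
  by apply/matrixP=> a b; rewrite !mxE conjCK.
by rewrite -row_mul !mxE; apply: eq_bigr => j _; rewrite !mxE.
Qed.

Lemma psd_spectral X : psd X ->
  exists U : 'M[C]_d, exists x : 'rV[C]_d,
  [/\ U *m U^t* = 1%:M, U^t* *m U = 1%:M, X = U^t* *m diag_mx x *m U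
    & forall i, 0 <= x 0 i].
Proof.
move=> hX; have [hh _] := hX.
have U1 : spectralmx X *m (spectralmx X)^t* = 1%:M.
  exact/unitarymxP/spectral_unitarymx.
have U2 := mulmx1C U1.
have XE : X = (spectralmx X)^t* *m diag_mx (spectral_diag X) *m spectralmx X.
  rewrite -invmx_unitary ?spectral_unitarymx//.
  exact/orthomx_spectralP/hermitian_normalmx.
exists (spectralmx X), (spectral_diag X); split => // i.
have := psd_conj_ge0 (spectralmx X) hX i.
rewrite {2}XE !mulmxA U1 mul1mx -mulmxA U1 mulmx1 mxE eqxx.
by rewrite mulr1n.
Qed.

Lemma expr_diag (x : 'rV[C]_d) k :
  diag_mx x ^+ k = diag_mx (\row_i x 0 i ^+ k).
Proof.
elim: k => [|k IH].
  rewrite expr0; apply/matrixP => i j; rewrite !mxE expr0.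
  by [].
rewrite exprS IH -[_ * _]/(_ *m _) mulmx_diag; congr diag_mx.
by apply/rowP=> i; rewrite !mxE exprS.
Qed.

Lemma expr_conj (U B : 'M[C]_d) k : U *m U^t* = 1%:M ->
  U^t* *m U = 1%:M -> (U^t* *m B *m U) ^+ k = U^t* *m B ^+ k *m U.
Proof.
move=> U1 U2; elim: k => [|k IH]; first by rewrite !expr0 -[1]/(1%:M) mulmx1 U2.
rewrite !exprS IH -[_ * _]/(_ *m _) -[B * _]/(_ *m _) !mulmxA.
by rewrite -[_ *m U *m U^t*]mulmxA U1 mulmx1.
Qed.

Lemma psd_trace_exp X k : psd X -> 0 <= \tr (X ^+ k).
Proof.
move=> /psd_spectral[U [x [U1 U2 -> x0]]].
rewrite expr_conj// mxtrace_mulC mulmxA U1 mul1mx expr_diag mxtrace_diag.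
by apply: sumr_ge0 => i _; rewrite mxE exprn_ge0.
Qed.

Lemma mxtrace_mulE (A D : 'M[C]_d) : \tr (A *m D) = \sum_i \sum_j A i j * D j i.
Proof. by apply: eq_bigr => i _; rewrite mxE. Qed.

(** In an eigenbasis of [X], with [E] the matrix of [D], the two traces are sums of [|E i j|^2]
    times [x_j^k x_i^l] and [x_i^(k+l)]. The rest is a Chebyshev-type inequality: both powers are
    nondecreasing on nonnegative reals. *)
Lemma trace_interlace X D k l : psd X -> D \is hermsymmx ->
  \tr (D *m X ^+ k *m D *m X ^+ l) <= \tr (D *m D *m X ^+ (k + l)).
Proof.
move=> /psd_spectral[U [x [U1 U2 -> x0]]] /hermsymmxP hD.
rewrite !expr_conj// !expr_diag.
have [E EE] : exists E, E = U *m D *m U^t* by eexists.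
have hE i j : E j i = (E i j)^*%R.
  have -> : E j i = (E^t* i j)^*%R by rewrite !mxE conjCK.
  congr (_ ^*%R); rewrite EE !trmx_mul !map_mxM/= trmxCK.
  by rewrite hD mulmxA.
have -> : \tr (D *m (U^t* *m diag_mx (\row_i x 0 i ^+ k) *m U) *m D *m
    (U^t* *m diag_mx (\row_i x 0 i ^+ l) *m U)) =
    \sum_i \sum_j `|E i j| ^+ 2 * (x 0 j ^+ k * x 0 i ^+ l).
  transitivity (\tr ((E *m diag_mx (\row_i x 0 i ^+ k)) *m
                     (E *m diag_mx (\row_i x 0 i ^+ l)))).
    by rewrite EE !mulmxA mxtrace_mulC !mulmxA.
  rewrite mxtrace_mulE; apply: eq_bigr => i _; apply: eq_bigr => j _.
  rewrite mul_mx_diag mul_mx_diag !mxE (hE i j) normCK.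
  ring.
have -> : \tr (D *m D *m (U^t* *m diag_mx (\row_i x 0 i ^+ (k + l)) *m U)) =
    \sum_i \sum_j `|E i j| ^+ 2 * x 0 i ^+ (k + l).
  have -> : D *m D = U^t* *m (E *m E) *m U.
    rewrite EE !mulmxA U2 mul1mx -!mulmxA U2 mulmx1.
    by rewrite (mulmxA (U^t*)) U2 mul1mx.
  rewrite !mulmxA mxtrace_mulC !mulmxA U1 mul1mx -!mulmxA (mulmxA U) U1 mul1mx.
  rewrite mulmxA mxtrace_mulE; under eq_bigr do under eq_bigr do
    rewrite [diag_mx _ _ _]mxE.
  apply: eq_bigr => i _; rewrite (bigD1 i)//= big1 ?addr0; last first.
    by move=> j /negPf ji; rewrite !mxE ji mulr0n mulr0.
  rewrite !mxE eqxx mulr1n mulr_suml; apply: eq_bigr => j _.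
  by rewrite (hE i j) normCK.
rewrite -subr_ge0 -(pmulr_lge0 _ (ltr0Sn C 1)).
set S := (X in 0 <= X * _).
(* Symmetrizing in [i] and [j], a sum of nonnegative terms. *)
have -> : S * 2 = \sum_i \sum_j `|E i j| ^+ 2 *
    ((x 0 i ^+ k - x 0 j ^+ k) * (x 0 i ^+ l - x 0 j ^+ l)).
  have SE : S = \sum_i \sum_j `|E i j| ^+ 2 *
      (x 0 i ^+ (k + l) - x 0 j ^+ k * x 0 i ^+ l).
    rewrite /S -sumrB; apply: eq_bigr => i _; rewrite -sumrB.
    by apply: eq_bigr => j _; rewrite mulrBr.
  have SE' : S = \sum_i \sum_j `|E i j| ^+ 2 *
      (x 0 j ^+ (k + l) - x 0 i ^+ k * x 0 j ^+ l).
    rewrite SE exchange_big/=; apply: eq_bigr => i _; apply: eq_bigr => j _.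
    by rewrite (hE i j) norm_conjC.
  rewrite mulr_natr mulr2n {1}SE SE' -big_split/=; apply: eq_bigr => i _.
  rewrite -big_split/=; apply: eq_bigr => j _; rewrite !exprD; ring.
apply: sumr_ge0 => i _; apply: sumr_ge0 => j _.
apply: mulr_ge0; first by rewrite exprn_ge0.
have : x 0 i >=< x 0 j by apply: real_comparable; exact: ger0_real.
by case/orP => h; [apply: mulr_le0|apply: mulr_ge0]; rewrite ?subr_le0 ?subr_ge0 lerXn2r ?nnegrE.
Qed.

(** Since [1 - D^2] is positive semidefinite, its diagonal entries in an eigenbasis of [X] are
    nonnegative; the difference of the traces weights them by [x_i^k]. *)
Lemma trace_contract X D k : psd X -> D \is hermsymmx ->
  (forall v : 'cV[C]_d, 0 <= (v^t* *m (1%:M - D *m D) *m v) 0 0) ->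
  \tr (D *m D *m X ^+ k) <= \tr (X ^+ k).
Proof.
move=> /psd_spectral[U [x [U1 U2 -> x0]]] /hermsymmxP hD hDD.
have hB : psd (1%:M - D *m D).
  split=> //; apply/hermsymmxP.
  rewrite raddfB/= map_mxB trmx1 map_mx1 trmx_mul map_mxM.
  by rewrite hD.
rewrite -subr_ge0 -linearB/= -{1}[_ ^+ k]mul1mx -mulmxBl.
rewrite expr_conj// expr_diag !mulmxA mxtrace_mulC !mulmxA mxtrace_mulE.
apply: sumr_ge0 => i _; rewrite (bigD1 i)//= big1 ?addr0; last first.
  by move=> j /negPf ji; rewrite !mxE ji mulr0n mulr0.
rewrite !mxE eqxx mulr1n mulr_ge0 ?exprn_ge0//.
have := psd_conj_ge0 U hB i; by rewrite !mxE.
Qed.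

End Psd.

(** * Truncated exponentials along a line of matrices *)

Section ReIm.
Variable R : realType.
Implicit Types x y : R[i].
Local Notation Re := (@complex.Re R).
Local Notation Im := (@complex.Im R).

Lemma ReD x y : Re (x + y) = Re x + Re y. Proof. by case: x; case: y. Qed.
Lemma ImD x y : Im (x + y) = Im x + Im y. Proof. by case: x; case: y. Qed.
Lemma ReM x y : Re (x * y) = Re x * Re y - Im x * Im y.
Proof. by case: x; case: y. Qed.
Lemma ImM x y : Im (x * y) = Re x * Im y + Im x * Re y.
Proof. by case: x => a b; case: y => a' b' /=; rewrite addrC. Qed.
Lemma ReB x y : Re (x - y) = Re x - Re y. Proof. by case: x; case: y. Qed.
Lemma ImB x y : Im (x - y) = Im x - Im y. Proof. by case: x; case: y. Qed.
Lemma Re_sum I (r : seq I) (P : pred I) (f : I -> R[i]) :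
  Re (\sum_(i <- r | P i) f i) = \sum_(i <- r | P i) Re (f i).
Proof. exact: (big_morph Re ReD). Qed.
Lemma le_Re x y : x <= y -> Re x <= Re y.
Proof. by rewrite lecE => /andP[]. Qed.
End ReIm.

(** * Differentiation of matrix polynomials in a real variable *)

Section Deriv.
Variables (R : realType) (d : nat).
Local Notation C := R[i].

(** Taken on real and imaginary parts, so that the calculus of real functions applies. *)
Definition cderiv (f : R -> C) (s : R) (l : C) :=
  is_derive s 1 (fun u => complex.Re (f u)) (complex.Re l) /\
  is_derive s 1 (fun u => complex.Im (f u)) (complex.Im l).

Lemma eq_cderiv f g s l l' : f =1 g -> l = l' -> cderiv f s l -> cderiv g s l'.
Proof. by move=> /funext-> ->. Qed.

Lemma cderiv_cst (a : C) s : cderiv (fun=> a) s 0.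
Proof. by split; exact: is_derive_cst. Qed.

Lemma cderivD f f' g g' s : cderiv f s f' -> cderiv g s g' ->
  cderiv (fun u => f u + g u) s (f' + g').
Proof.
move=> [f1 f2] [g1 g2]; split.
  by under eq_fun do rewrite ReD; rewrite ReD; apply: is_deriveD.
by under eq_fun do rewrite ImD; rewrite ImD; apply: is_deriveD.
Qed.

Lemma cderivM f f' g g' s : cderiv f s f' -> cderiv g s g' ->
  cderiv (fun u => f u * g u) s (f' * g s + f s * g').
Proof.
move=> [f1 f2] [g1 g2]; split.
  under eq_fun do rewrite ReM; rewrite ReD !ReM.
  apply: is_derive_eq.
  rewrite /GRing.scale/=; ring.
under eq_fun do rewrite ImM; rewrite ImD !ImM.
apply: is_derive_eq.
rewrite /GRing.scale/=; ring.
Qed.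

Lemma cderiv_sum I (r : seq I) (f : I -> R -> C) (f' : I -> C) s :
  (forall i, cderiv (f i) s (f' i)) ->
  cderiv (fun u => \sum_(i <- r) f i u) s (\sum_(i <- r) f' i).
Proof.
move=> h; elim: r => [|i r IH].
  by apply: (eq_cderiv _ _ (cderiv_cst 0 s)) => [u|]; rewrite big_nil.
by apply: (eq_cderiv _ _ (cderivD (h i) IH)) => [u|]; rewrite big_cons.
Qed.

Lemma cderiv_line (a b : C) s : cderiv (fun u => a + u%:C * b) s b.
Proof.
case: a b => a a' [b b']; split => /=.
  under eq_fun do rewrite mul0r subr0.
  by apply: is_derive_eq; rewrite /GRing.scale/=; ring.
under eq_fun do rewrite mul0r addr0.
by apply: is_derive_eq; rewrite /GRing.scale/=; ring.
Qed.

Definition mxderiv m n (M : R -> 'M[C]_(m, n)) s (L : 'M[C]_(m, n)) :=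
  forall i j, cderiv (fun u => M u i j) s (L i j).

Lemma mxderivM m n p (M : R -> 'M[C]_(m, n)) (N : R -> 'M[C]_(n, p)) s M' N' :
  mxderiv M s M' -> mxderiv N s N' ->
  mxderiv (fun u => M u *m N u) s (M' *m N s + M s *m N').
Proof.
move=> hM hN i j.
apply: (eq_cderiv _ _ (cderiv_sum (index_enum 'I_n)
  (fun k => cderivM (hM i k) (hN k j)))) => [u|]; first by rewrite !mxE.
by rewrite !mxE -big_split.
Qed.

Lemma mxderiv_sum m n I (r : seq I) (M : I -> R -> 'M[C]_(m, n)) s M' :
  (forall i, mxderiv (M i) s (M' i)) ->
  mxderiv (fun u => \sum_(i <- r) M i u) s (\sum_(i <- r) M' i).
Proof.
move=> h i j.
by apply: (eq_cderiv _ _ (cderiv_sum r (fun k => h k i j))) => [u|];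
  rewrite summxE.
Qed.

Lemma mxderiv_cst m n (M : 'M[C]_(m, n)) s : mxderiv (fun=> M) s 0.
Proof.
by move=> i j; apply: (eq_cderiv _ _ (cderiv_cst (M i j) s)) => //; rewrite mxE.
Qed.

Lemma mxderivZ m n (M : R -> 'M[C]_(m, n)) s M' (a : C) : mxderiv M s M' ->
  mxderiv (fun u => a *: M u) s (a *: M').
Proof.
move=> h i j.
apply: (eq_cderiv _ _ (cderivM (cderiv_cst a s) (h i j))) => [u|];
  by rewrite !mxE// mul0r add0r.
Qed.

Lemma mxderiv_line m n (X D : 'M[C]_(m, n)) s :
  mxderiv (fun u => X + u%:C *: D) s D.
Proof.
move=> i j; apply: (eq_cderiv _ _ (cderiv_line (X i j) (D i j) s)) => // u.
by rewrite !mxE.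
Qed.

Lemma cderiv_mxtrace (M : R -> 'M[C]_d) s M' : mxderiv M s M' ->
  cderiv (fun u => \tr (M u)) s (\tr M').
Proof. by move=> h; apply: cderiv_sum => i; exact: h. Qed.

(* The derivative of [s => (X + s D) ^+ k] at [0]. *)
Definition dpow (X D : 'M[C]_d) k := \sum_(j < k) X ^+ j * D * X ^+ (k.-1 - j).

Lemma mxderiv_exp (X D : 'M[C]_d) k s :
  mxderiv (fun u => (X + u%:C *: D) ^+ k) s (dpow (X + s%:C *: D) D k).
Proof.
elim: k => [|k IH]; first by rewrite /dpow big_ord0; exact: mxderiv_cst.
move=> i j.
apply: (eq_cderiv _ _ (mxderivM (mxderiv_line X D s) IH i j)) => [u|].
  by rewrite exprS.
rewrite /dpow big_ord_recl/= expr0 mul1r subn0; congr (fun_of_matrix (_ + _) i j).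
rewrite mulmx_sumr; apply: eq_bigr => l _.
rewrite -[_ *m _]/(_ * _) !mulrA -exprS; congr (_ * _ ^+ _).
(* Subtraction is truncated: at [k = 0] there is no index [l], and otherwise [k - (l + 1)] and
   [k.-1 - l] agree. *)
by rewrite /bump add1n; case: k {IH} l => [[]|k l] //=; rewrite subSS.
Qed.

Let scale_mulr (a : C) (A B : 'M[C]_d) : A * (a *: B) = a *: (A * B).
Proof. exact: esym (scalemxAr _ _ _). Qed.

Lemma mxtrace_sum n (F : 'I_n -> 'M[C]_d) : \tr (\sum_i F i) = \sum_i \tr (F i).
Proof. exact: raddf_sum. Qed.

(** The exponential series cut after [N] terms: a polynomial, so that derivatives, measurability and
    boundedness reduce to algebra on entries. *)
Definition mexp N (X : 'M[C]_d) : 'M[C]_d :=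
  \sum_(k < N) (k`!%:R)^-1 *: X ^+ k.

(** Under the trace the [k] terms of [dpow X D k] coincide by cyclicity, and
    [k / k! = 1 / (k - 1)!]. Differentiation costs one term of the truncation. *)
Lemma trace_dmexp (X D : 'M[C]_d) N :
  \tr (\sum_(k < N.+1) (k`!%:R)^-1 *: dpow X D k) = \tr (D * mexp N X).
Proof.
rewrite big_ord_recl {1}/dpow big_ord0 scaler0 add0r.
rewrite /mexp mulr_sumr !mxtrace_sum; apply: eq_bigr => k _.
rewrite /= /bump add1n scale_mulr !mxtraceZ /dpow mxtrace_sum.
rewrite (eq_bigr (fun=> \tr (D * X ^+ k))); last first.
  move=> j _; transitivity (\tr (X ^+ (k - j) * X ^+ j * D)).
    by rewrite -[in RHS]mulrA; exact: mxtrace_mulC.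
  rewrite -exprD subnK; last by rewrite -ltnS.
  exact: mxtrace_mulC.
rewrite sumr_const card_ord factS natrM invfM -[\tr _ *+ _]mulr_natl /GRing.scale/=.
by rewrite mulrACA mulVf ?mul1r ?pnatr_eq0.
Qed.

(** This is [phi'' <= phi] up to truncation: [trace_interlace] brings the two copies of [D] together
    in each term, and [trace_contract] removes them. *)
Lemma trace_dmexp2_le (X D : 'M[C]_d) N : psd X -> D \is hermsymmx ->
  (forall v : 'cV[C]_d, 0 <= (v^t* *m (1%:M - D *m D) *m v) 0 0) ->
  \tr (D * \sum_(k < N.+1) (k`!%:R)^-1 *: dpow X D k) <= \tr (mexp N X).
Proof.
move=> hX hD hDD.
rewrite big_ord_recl {1}/dpow big_ord0 scaler0 add0r.
rewrite /mexp mulr_sumr !mxtrace_sum; apply: ler_sum => k _.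
rewrite /= /bump add1n scale_mulr !mxtraceZ /dpow [D * _]mulr_sumr mxtrace_sum.
apply: (@le_trans _ _ (((k.+1)`!%:R)^-1 * (k.+1%:R * \tr (X ^+ k)))).
  apply: ler_wpM2l; first by rewrite invr_ge0.
  rewrite mulr_natl -[X in _ *+ X]card_ord -sumr_const; apply: ler_sum => j _.
  rewrite !mulrA; apply: le_trans (trace_interlace _ _ hX hD) _.
  rewrite subnKC; last by rewrite -ltnS.
  exact: trace_contract.
rewrite factS natrM invfM [X in X * _]mulrC -mulrA mulKf ?pnatr_eq0//.
Qed.

(** Restores the terms lost by differentiation; positivity of [X] makes the added term
    nonnegative. *)
Lemma trace_mexp_le (X : 'M[C]_d) N : psd X ->
  \tr (mexp N X) <= \tr (mexp N.+1 X).
Proof.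
move=> hX; rewrite /mexp big_ord_recr/= linearD/= lerDl linearZ/=.
by rewrite mulr_ge0 ?psd_trace_exp// invr_ge0.
Qed.

End Deriv.

(** * A second-order differential inequality *)

Section Gronwall.
Variable R : realType.

(* [(f' + f) e^-s] is nonincreasing, hence so is
   [f e^s - (f' 0 + f 0) e^(2 s) / 2]. *)
Lemma second_order_comparison (f f1 f2 : R -> R) (l : R) : 0 <= l ->
  (forall s : R, is_derive s (1 : R) f (f1 s)) -> (forall s : R, is_derive s (1 : R) f1 (f2 s)) ->
  (forall s : R, 0 <= s <= l -> f2 s <= f s) ->
  f l <= (expR l + expR (- l)) / 2 * f 0 + (expR l - expR (- l)) / 2 * f1 0.
Proof.
move=> l0 df df1 h.
have decr (g g' : R -> R) (x : R) : 0 <= x <= l -> (forall s : R, is_derive s (1 : R) g (g' s)) ->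
    (forall s : R, 0 <= s <= l -> g' s <= 0) -> g x <= g 0.
  move=> /andP[x0 xl] dg hg.
  apply: (@ler0_derive1_le_cc _ g 0 x) => //.
  - move=> y; rewrite in_itv/= => /andP[y0 yx]; rewrite derive1E (_ : 'D_1 g y = g' y); last by have [] := dg y.
    by apply: hg; rewrite (ltW y0) (le_trans (ltW yx)).
  - apply: continuous_subspaceT => y; apply/differentiable_continuous/derivable1_diffP.
    by have [] := dg y.
  - by rewrite in_itv/= x0 lexx.
  - by rewrite in_itv/= x0 lexx.
set a := f1 0 + f 0.
have h1 (s : R) : 0 <= s <= l -> f1 s + f s <= a * expR s.
  move=> sl.
  rewrite -ler_pdivrMr ?expR_gt0// -expRN.
  have := decr (fun u => (f1 u + f u) * expR (- u))
    (fun u => (f2 u - f u) * expR (- u)) s sl.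
  rewrite /= oppr0 expR0 mulr1; apply.
    move=> u; apply: is_derive_eq; rewrite /GRing.scale/=; ring.
  by move=> u ul; apply: mulr_le0_ge0; rewrite ?expR_ge0// subr_le0; exact: h.
have := decr (fun u => f u * expR u - a / 2 * (expR u * expR u))
   (fun u => (f1 u + f u - a * expR u) * expR u) l.
rewrite l0 lexx => /(_ isT) h2.
have {h2} : f l * expR l - a / 2 * (expR l * expR l) <= f 0 - a / 2.
  have -> : f 0 - a / 2 = f 0 * expR 0 - a / 2 * (expR 0 * expR 0).
    by rewrite expR0 !mulr1.
  apply: h2.
    by move=> u; apply: is_derive_eq; rewrite /GRing.scale/=; field.
  by move=> u ul; apply: mulr_le0_ge0; rewrite ?expR_ge0// subr_le0; exact: h1.
have e0 := expR_gt0 l.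
move=> h2; rewrite expRN -(ler_pM2r e0).
set e := expR l in e0 h2 *.
have -> : ((e + e^-1) / 2 * f 0 + (e - e^-1) / 2 * f1 0) * e =
   f 0 - a / 2 + a / 2 * (e * e).
  rewrite /a; field; exact: lt0r_neq0.
lra.
Qed.

End Gronwall.

Section OneStep.
Variables (R : realType) (d : nat).
Local Notation C := R[i].

(** The comparison is applied to [phi s = tr (mexp N.+2 (X + s D))]. Two derivatives lower the
    truncation to [N], and positivity along the segment brings it back to [N.+2]. *)
Lemma trace_mexp_step (X D : 'M[C]_d) (l : R) N : 0 <= l ->
  (forall s : R, 0 <= s <= l -> psd (X + s%:C *: D)) -> D \is hermsymmx ->
  (forall v : 'cV[C]_d, 0 <= (v^t* *m (1%:M - D *m D) *m v) 0 0) ->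
  complex.Re (\tr (mexp N.+2 (X + l%:C *: D))) <=
  (expR l + expR (- l)) / 2 * complex.Re (\tr (mexp N.+2 X)) +
  (expR l - expR (- l)) / 2 * complex.Re (\tr (D * mexp N.+1 X)).
Proof.
move=> l0 hX hD hDD.
pose Z s := X + s%:C *: D.
have Z0 : Z 0 = X by rewrite /Z scale0r addr0.
have dm M s : mxderiv (fun u => mexp M (Z u)) s
    (\sum_(k < M) (k`!%:R)^-1 *: dpow (Z s) D k).
  by apply: mxderiv_sum => k; apply: mxderivZ; exact: mxderiv_exp.
have := @second_order_comparison R (fun s => complex.Re (\tr (mexp N.+2 (Z s))))
  (fun s => complex.Re (\tr (D * mexp N.+1 (Z s))))
  (fun s => complex.Re (\tr (D * \sum_(k < N.+1) (k`!%:R)^-1 *: dpow (Z s) D k))) l l0.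
rewrite Z0; apply.
- by move=> s; rewrite -trace_dmexp; have [] := cderiv_mxtrace (dm N.+2 s).
- move=> s.
  have [+ _] := cderiv_mxtrace (mxderivM (mxderiv_cst D s) (dm N.+1 s)).
  by rewrite mul0mx add0r.
- move=> s sl; apply: le_Re.
  apply: le_trans (trace_dmexp2_le _ (hX s sl) hD hDD) _.
  by apply: le_trans (trace_mexp_le _ (hX s sl)) _; exact: trace_mexp_le (hX s sl).
Qed.

End OneStep.

(** * Operator norm and largest eigenvalue *)

Section PsdCone.
Variables (R : realType) (d : nat).
Local Notation C := R[i].
Implicit Types (A B D : 'M[C]_d).

Lemma hermsymmxD A B : A \is hermsymmx -> B \is hermsymmx -> A + B \is hermsymmx.
Proof.
move=> /hermsymmxP hA /hermsymmxP hB; apply/hermsymmxP.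
by rewrite linearD/= map_mxD hA hB.
Qed.

Lemma hermsymmxZ (a : R) A : A \is hermsymmx -> a%:C *: A \is hermsymmx.
Proof.
move=> /hermsymmxP hA; apply/hermsymmxP; rewrite linearZ/= map_mxZ hA.
by congr (_ *: _); exact: conjc_real.
Qed.

Lemma hermsymmxB A B : A \is hermsymmx -> B \is hermsymmx -> A - B \is hermsymmx.
Proof.
move=> hA hB.
have <- : (-1 : R)%:C *: B = - B by rewrite rmorphN1 scaleN1r.
exact: (hermsymmxD hA (hermsymmxZ (-1) hB)).
Qed.

Lemma psd1 : psd (1%:M : 'M[C]_d).
Proof.
split; first by apply/hermsymmxP; rewrite trmx1 map_mx1.
move=> v; rewrite mulmx1 mxE; apply: sumr_ge0 => i _; rewrite !mxE mulrC.
exact: mul_conjC_ge0.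
Qed.

Lemma psdD A B : psd A -> psd B -> psd (A + B).
Proof.
move=> [hA pA] [hB pB]; split; first exact: hermsymmxD.
move=> v; rewrite mulmxDr mulmxDl mxE.
exact: (addr_ge0 (pA v) (pB v)).
Qed.

Lemma psdZ (a : R) A : 0 <= a -> psd A -> psd (a%:C *: A).
Proof.
move=> a0 [hA pA]; split; first exact: hermsymmxZ.
by move=> v; rewrite -scalemxAr -scalemxAl mxE mulr_ge0// ler0c.
Qed.

Lemma psd_sqr D : D \is hermsymmx -> psd (D *m D).
Proof.
move=> /hermsymmxP hD; split.
  by apply/hermsymmxP; rewrite trmx_mul map_mxM hD.
move=> v; rewrite -{1}hD mulmxA -mulmxA.
have -> : v^t* *m D^t* = (D *m v)^t* by rewrite trmx_mul map_mxM.
rewrite mxE; apply: sumr_ge0 => i _.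
by rewrite !mxE mulrC mul_conjC_ge0.
Qed.

(** Yields [-1 <= D] for a contraction [D], the source of the shift that makes the martingale
    positive. *)
Lemma psd_1D D : D \is hermsymmx -> psd (1%:M - D *m D) -> psd (1%:M + D).
Proof.
move=> hD hDD.
have h1D : 1%:M + D \is hermsymmx by exact: (hermsymmxD psd1.1 hD).
(* 2 (1 + D) = (1 + D)^2 + (1 - D^2) *)
have -> : 1%:M + D = (2^-1 : R)%:C *: ((1%:M + D) *m (1%:M + D) + (1%:M - D *m D)).
  rewrite mulmxDl !mulmxDr !mul1mx !mulmx1.
  have -> : 1%:M + D + (D + D *m D) + (1%:M - D *m D) = (2 : R)%:C *: (1%:M + D).
    by rewrite rmorph_nat scaler_nat; apply/matrixP => i j; rewrite !mxE; ring.
  by rewrite scalerA -rmorphM/= mulVf ?scale1r// pnatr_eq0.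
have h2 : 0 <= (2^-1 : R) by rewrite invr_ge0.
exact: (psdZ h2 (psdD (psd_sqr h1D) hDD)).
Qed.

End PsdCone.

Section Opnorm.
Variables (R : realType) (d : nat).
Local Notation C := R[i].
Implicit Types (A D : 'M[C]_d) (v : 'cV[C]_d).

Lemma l2norm_ge0 v : 0 <= l2norm v. Proof. exact: sqrtr_ge0. Qed.

Lemma l2norm_sqr v : (l2norm v ^+ 2)%:C = \sum_k `|v k 0| ^+ 2.
Proof.
rewrite sqr_sqrtr; last by apply: sumr_ge0 => k _; rewrite addr_ge0 ?sqr_ge0.
by rewrite rmorph_sum; apply: eq_bigr => k _; exact: add_Re2_Im2.
Qed.

Lemma l2norm_sqrE v : (l2norm v ^+ 2)%:C = (v^t* *m v) 0 0.
Proof.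
rewrite l2norm_sqr mxE; apply: eq_bigr => k _.
by rewrite !mxE normCK mulrC.
Qed.

Lemma l2normZ (a : R) v : 0 <= a -> l2norm (a%:C *: v) = a * l2norm v.
Proof.
move=> a0; apply/eqP; rewrite -(@eqrXn2 _ 2)// ?mulr_ge0 ?l2norm_ge0//.
rewrite exprMn -(inj_eq (@complexI R)); apply/eqP.
transitivity ((a ^+ 2)%:C * (l2norm v ^+ 2)%:C); last by rewrite -rmorphM.
rewrite !l2norm_sqr mulr_sumr; apply: eq_bigr => k _; rewrite mxE normrM exprMn rmorphXn/=.
by rewrite [X in X ^+ 2](_ : _ = a%:C)// ger0_norm// ler0c.
Qed.

Lemma l2norm_eq0 v : l2norm v = 0 -> v = 0.
Proof.
move=> v0; apply/matrixP => i j; rewrite (ord1 j) mxE.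
have := l2norm_sqr v; rewrite v0 expr0n/= => /esym/eqP.
rewrite psumr_eq0; last by move=> k _; rewrite exprn_ge0.
by move=> /allP/(_ i (mem_index_enum _)); rewrite expf_eq0/= normr_eq0 => /eqP.
Qed.

(** [sup] takes a default value on unbounded sets, so boundedness must be shown. On the unit ball
    each [|v_j| <= 1], whence a bound by absolute row sums. *)
Lemma opnorm_has_sup A :
  has_sup [set l2norm (A *m v) | v in [set v : 'cV[C]_d | l2norm v <= 1]].
Proof.
split.
  exists (l2norm (A *m 0)), 0 => //=; rewrite /l2norm big1 ?sqrtr0//.
  by move=> k _; rewrite mxE/= expr0n addr0.
pose M : R := \sum_k (\sum_j complex.Re `|A k j|) ^+ 2.
exists (Num.sqrt M) => _ [v /= v1 <-].
rewrite -ler_sqr ?nnegrE ?sqrtr_ge0 ?l2norm_ge0//.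
rewrite [Num.sqrt M ^+ 2]sqr_sqrtr; last by apply: sumr_ge0 => k _; rewrite sqr_ge0.
rewrite -lecR l2norm_sqr /M [leRHS]rmorph_sum; apply: ler_sum => k _.
rewrite [leRHS](_ : _ = (\sum_j `|A k j|) ^+ 2); last first.
  transitivity ((\sum_j complex.Re `|A k j|)%:C ^+ 2); first exact: rmorphXn.
  congr (_ ^+ 2); rewrite rmorph_sum; apply: eq_bigr => j _.
  exact: RRe_real (normr_real _).
apply: lerXn2r; rewrite ?nnegrE ?sumr_ge0//.
rewrite mxE (le_trans (ler_norm_sum _ _ _))//; apply: ler_sum => j _.
rewrite normrM ler_piMr//.
rewrite -ler_sqr ?nnegrE// expr1n.
apply: (@le_trans _ _ ((l2norm v ^+ 2)%:C)); last first.
  by rewrite (_ : 1 = (1 : R)%:C)// lecR exprn_ile1 ?l2norm_ge0.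
by rewrite l2norm_sqr (bigD1 j)//= lerDl; apply: sumr_ge0 => ? _; rewrite exprn_ge0.
Qed.

Lemma opnorm_contract A : opnorm A <= 1 -> forall v, l2norm (A *m v) <= l2norm v.
Proof.
move=> A1 v; have [v0|v0] := eqVneq (l2norm v) 0.
  by rewrite (l2norm_eq0 v0) mulmx0.
have vp : 0 < l2norm v by rewrite lt_neqAle eq_sym v0 l2norm_ge0.
have ivp : 0 <= (l2norm v)^-1 by rewrite invr_ge0 l2norm_ge0.
have : l2norm (A *m ((l2norm v)^-1%:C *: v)) <= 1.
  apply: le_trans A1; apply: (sup_upper_bound (opnorm_has_sup A)).
  by exists ((l2norm v)^-1%:C *: v) => //=; rewrite l2normZ// mulVf.
by rewrite -scalemxAr l2normZ// mulrC ler_pdivrMr// mul1r.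
Qed.

(** The quadratic form of [1 - D^2] at [v] is [|v|^2 - |D v|^2]. *)
Lemma opnorm_psd D : D \is hermsymmx -> opnorm D <= 1 -> psd (1%:M - D *m D).
Proof.
move=> hD D1; split.
  exact: (hermsymmxB (@psd1 R d).1 (psd_sqr hD).1).
move=> v; rewrite mulmxBr mulmx1 mulmxBl [X in 0 <= X](_ : _ =
  (l2norm v ^+ 2)%:C - (l2norm (D *m v) ^+ 2)%:C); last first.
  rewrite !l2norm_sqrE trmx_mul map_mxM (elimT (hermsymmxP D) hD).
  by rewrite [LHS]mxE [X in _ + X = _]mxE !mulmxA.
by rewrite subr_ge0 lecR lerXn2r ?nnegrE ?l2norm_ge0 ?opnorm_contract.
Qed.

Lemma opnorm_entry A i j : opnorm A <= 1 ->
  `|complex.Re (A i j)| <= 1 /\ `|complex.Im (A i j)| <= 1.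
Proof.
move=> A1; have := opnorm_contract A1 (delta_mx j 0).
have -> : l2norm (delta_mx j 0 : 'cV[C]_d) = 1.
  apply/eqP; rewrite -(@eqrXn2 _ 2)// ?l2norm_ge0// expr1n.
  rewrite -(inj_eq (@complexI R)) l2norm_sqr (bigD1 j)//= big1 ?addr0.
    by rewrite mxE !eqxx normr1 expr1n.
  by move=> k /negPf kj; rewrite mxE kj normr0 expr0n.
move=> h.
have {h} : complex.Re (A i j) ^+ 2 + complex.Im (A i j) ^+ 2 <= 1.
  rewrite -lecR add_Re2_Im2.
  apply: (@le_trans _ _ ((l2norm (A *m delta_mx j 0) ^+ 2)%:C)); last first.
    by rewrite lecR exprn_ile1 ?l2norm_ge0.
  rewrite l2norm_sqr -colE (bigD1 i)//= mxE lerDl.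
  by apply: sumr_ge0 => ? _; rewrite exprn_ge0.
move=> h; split; rewrite -ler_sqr ?nnegrE// expr1n real_normK ?num_real//;
 apply: le_trans h; by rewrite ?lerDl ?lerDr sqr_ge0.
Qed.

End Opnorm.

(** * Largest eigenvalue and trace exponential *)

Section GammaMax.
Variables (R : realType) (d : nat).
Local Notation C := R[i].
Implicit Types (A : 'M[C]_d).

(** The real eigenvalues of [A] are exactly its diagonal entries in a spectral decomposition; the
    supremum becomes a maximum over a finite index set, nonempty as [0 < d]. *)
Lemma gamma_max_spectral A : (0 < d)%N -> A \is hermsymmx ->
  exists U : 'M[C]_d, exists x : 'I_d -> R,
  [/\ U *m U^t* = 1%:M, U^t* *m U = 1%:M,
     A = U^t* *m diag_mx (\row_i (x i)%:C) *m U,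
     exists i, gamma_max A = x i & forall i, x i <= gamma_max A].
Proof.
move=> d0 hA.
have U1 : spectralmx A *m (spectralmx A)^t* = 1%:M.
  exact/unitarymxP/spectral_unitarymx.
have U2 := mulmx1C U1.
have AE : A = (spectralmx A)^t* *m diag_mx (spectral_diag A) *m spectralmx A.
  rewrite -invmx_unitary ?spectral_unitarymx//.
  exact/orthomx_spectralP/hermitian_normalmx.
pose x i := complex.Re (spectral_diag A 0 i).
have xE : spectral_diag A = \row_i (x i)%:C.
  apply/rowP => i; rewrite mxE /x RRe_real//.
  by have /mxOverP := hermitian_spectral_diag_real hA; apply.
rewrite xE in AE.
set U := spectralmx A in U1 U2 AE.
exists U, x.
have eigE (r : R) : eigenvalue A r%:C <-> exists i, r = x i.
  split.
    (* [eigenvalue] concerns row vectors; right multiplication by the adjoint of [U] carries [v] to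
       an eigenvector of the diagonal matrix. *)
    move=> /eigenvalueP[v vA v0].
    have [w wE] : exists w, w = v *m U^t* by eexists.
    have w0 : w != 0.
      apply: contra v0 => /eqP w0; rewrite -(mulmx1 v) -U2 mulmxA -wE w0.
      by rewrite mul0mx.
    have wD : w *m diag_mx (\row_i (x i)%:C) = r%:C *: w.
      by rewrite wE scalemxAl -vA [in RHS]AE -!mulmxA U1 mulmx1.
    have [i wi] : exists i, w 0 i != 0.
      apply/existsP; apply: contraNT w0; rewrite negb_exists => /forallP h.
      by apply/eqP/rowP => i; rewrite [RHS]mxE; have := h i; rewrite negbK => /eqP.
    exists i; have /matrixP/(_ 0 i) := wD.
    rewrite mul_mx_diag !mxE mulrC => /(mulIf wi) /(@complexI R) //.
  move=> [i ->]; apply/eigenvalueP; exists (row i U).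
    rewrite {1}AE -row_mul !mulmxA U1 mul1mx mul_diag_mx.
    by apply/rowP => j; rewrite !mxE.
  apply/eqP => /(congr1 (mulmx^~ (U^t*))); rewrite -row_mul U1 mul0mx.
  by move=> /rowP/(_ i)/eqP; rewrite !mxE eqxx oner_eq0.
pose i0 := Ordinal d0.
have [im _ hm] := @Order.TotalTheory.arg_maxP _ _ _ i0 predT x isT.
have gE : gamma_max A = x im.
  apply/eqP; rewrite eq_le; apply/andP; split.
    apply: ge_sup; first by exists (x im); apply/eigE; exists im.
    by move=> r /= /eigE[i ->]; exact: hm.
  apply: ub_le_sup; last by apply/eigE; exists im.
  by exists (x im) => r /= /eigE[i ->]; exact: hm.
split => //; first by exists im.
by move=> i; rewrite gE; exact: hm.
Qed.

Lemma spectral_affine (U A : 'M[C]_d) (x : 'I_d -> R) (a c : R) :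
  U^t* *m U = 1%:M -> A = U^t* *m diag_mx (\row_i (x i)%:C) *m U ->
  a%:C *: A + c%:C%:M = U^t* *m diag_mx (\row_i (a * x i + c)%:C) *m U.
Proof.
move=> U2 AE.
have -> : diag_mx (\row_i (a * x i + c)%:C) =
    a%:C *: diag_mx (\row_i (x i)%:C) + c%:C%:M :> 'M[C]_d.
  apply/matrixP => i j; rewrite !mxE; case: eqVneq => _; rewrite ?mulr1n ?mulr0n.
    by rewrite rmorphD rmorphM.
  by rewrite mulr0 addr0.
rewrite mulmxDr mulmxDl -scalemxAr -scalemxAl -AE; congr (_ + _).
by rewrite scalar_mxC -mulmxA U2 mulmx1.
Qed.

Lemma trace_mexp_spectral (U A : 'M[C]_d) (x : 'I_d -> R) (a c : R) N :
  U *m U^t* = 1%:M -> U^t* *m U = 1%:M ->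
  A = U^t* *m diag_mx (\row_i (x i)%:C) *m U ->
  complex.Re (\tr (mexp N (a%:C *: A + c%:C%:M))) =
  \sum_i series (exp_coeff (a * x i + c)) N.
Proof.
move=> U1 U2 AE; rewrite (spectral_affine _ _ U2 AE).
rewrite /mexp mxtrace_sum Re_sum.
have E k : complex.Re (\tr ((k`!%:R)^-1 *:
    (U^t* *m diag_mx (\row_i (a * x i + c)%:C) *m U) ^+ k)) =
    \sum_i exp_coeff (a * x i + c) k.
  rewrite mxtraceZ expr_conj// mxtrace_mulC mulmxA U1 mul1mx expr_diag.
  rewrite mxtrace_diag mulr_sumr Re_sum; apply: eq_bigr => i _.
  rewrite !mxE -rmorphXn -(rmorph_nat (real_complex R)) -fmorphV -rmorphM/=.
  by rewrite /exp_coeff/= mulrC.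
under eq_bigr do rewrite E.
rewrite exchange_big/=; apply: eq_bigr => i _.
by rewrite /series/= big_mkord.
Qed.

Lemma trace_mexp_scalar (c : R) N :
  complex.Re (\tr (mexp N (c%:C%:M : 'M[C]_d))) = d%:R * series (exp_coeff c) N.
Proof.
(* The scalar matrix is [0 *: 0 + c], and [0] is diagonalized by the identity. *)
have := @trace_mexp_spectral 1%:M 0 (fun=> 0) 0 c N.
rewrite scale0r add0r trmx1 map_mx1 mulmx1 => -> //.
  by under eq_bigr do rewrite mul0r add0r; rewrite sumr_const card_ord mulr_natl.
rewrite mul1mx mulmx1; apply/matrixP => i j; rewrite !mxE.
by case: eqVneq; rewrite ?mulr0n ?mulr1n.
Qed.

Lemma trace_mexp_ge0 (X : 'M[C]_d) N : psd X -> 0 <= complex.Re (\tr (mexp N X)).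
Proof.
move=> hX; rewrite -[leLHS]/(complex.Re (0 : C)); apply: le_Re.
rewrite /mexp mxtrace_sum; apply: sumr_ge0 => k _.
by rewrite mxtraceZ mulr_ge0 ?psd_trace_exp// invr_ge0.
Qed.

(** All eigenvalues of the affine image are nonnegative, so the trace dominates the contribution of
    the top one, and truncated exponentials are nondecreasing on nonnegative reals. *)
Lemma trace_mexp_gamma_max_ge A (a c u : R) N : (0 < d)%N -> A \is hermsymmx ->
  psd (a%:C *: A + c%:C%:M) -> 0 <= a -> 0 <= a * u + c -> u <= gamma_max A ->
  series (exp_coeff (a * u + c)) N <=
  complex.Re (\tr (mexp N (a%:C *: A + c%:C%:M))).
Proof.
move=> d0 hA hX a0 auc ug.
have [U [x [U1 U2 AE [i gi] xg]]] := gamma_max_spectral d0 hA.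
rewrite (trace_mexp_spectral _ _ _ U1 U2 AE).
have x0 j : 0 <= a * x j + c.
  have := psd_conj_ge0 U hX j; rewrite (spectral_affine _ _ U2 AE) !mulmxA U1 mul1mx.
  by rewrite -mulmxA U1 mulmx1 !mxE eqxx mulr1n ler0c.
rewrite (bigD1 i)//= -[leLHS]addr0; apply: lerD.
  rewrite /series/=; apply: ler_sum => k _; rewrite /exp_coeff/=.
  rewrite ler_wpM2r ?invr_ge0// lerXn2r ?nnegrE//.
  by rewrite lerD2r ler_wpM2l// -gi.
by apply: sumr_ge0 => j _; rewrite /series/=; apply: sumr_ge0 => k _; exact: exp_coeff_ge0.
Qed.

End GammaMax.

(** * Measurability *)

Section PointwiseRing.
Context (T : Type) (R : realType).
Local Notation C := R[i].
Variable Q : (T -> C) -> Prop.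
Hypotheses (Qcst : forall a : C, Q (fun=> a))
  (QD : forall f g, Q f -> Q g -> Q (fun w => f w + g w))
  (QM : forall f g, Q f -> Q g -> Q (fun w => f w * g w)).

Definition entrywise m n (M : T -> 'M[C]_(m, n)) :=
  forall i j, Q (fun w => M w i j).

Lemma closed_sum I (r : seq I) (f : I -> T -> C) :
  (forall i, Q (f i)) -> Q (fun w => \sum_(i <- r) f i w).
Proof.
move=> h; elim: r => [|i r IH]; first by under eq_fun do rewrite big_nil.
by under eq_fun do rewrite big_cons; exact: QD.
Qed.

Lemma entrywise_mulmx m n p (M : T -> 'M[C]_(m, n)) (N : T -> 'M[C]_(n, p)) :
  entrywise M -> entrywise N -> entrywise (fun w => M w *m N w).
Proof.
move=> hM hN i j; under eq_fun do rewrite mxE.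
by apply: closed_sum => k; exact: QM.
Qed.

Lemma entrywise_exp d (M : T -> 'M[C]_d) k :
  entrywise M -> entrywise (fun w => M w ^+ k).
Proof.
move=> hM; elim: k => [|k IH]; first by move=> i j; under eq_fun do rewrite expr0.
by under eq_fun do rewrite exprS; exact: entrywise_mulmx.
Qed.

(** The entries are polynomials in those of [M]. The abstract [Q] serves measurability and almost
    sure boundedness alike. *)
Lemma entrywise_mexp d (M : T -> 'M[C]_d) N (a : C) (B : 'M[C]_d) :
  entrywise M -> entrywise (fun w => mexp N (a *: M w + B)).
Proof.
move=> hM i j; rewrite /mexp; under eq_fun do rewrite summxE.
apply: closed_sum => k; under eq_fun do rewrite mxE; apply: QM => //.
apply: (@entrywise_exp _ (fun w => a *: M w + B)) => {}i {}j.
by under eq_fun do rewrite !mxE; apply: QD => //; exact: QM.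
Qed.

Lemma closed_trace d (M : T -> 'M[C]_d) : entrywise M -> Q (fun w => \tr (M w)).
Proof. by move=> hM; apply: closed_sum => i; exact: hM. Qed.

End PointwiseRing.

Section Measurability.
Context (disp : measure_display) (T : measurableType disp) (R : realType).
Local Notation C := R[i].

Definition cmeasurable (f : T -> C) :=
  measurable_fun setT (fun w => complex.Re (f w)) /\
  measurable_fun setT (fun w => complex.Im (f w)).

Lemma cmeasurable_cst (a : C) : cmeasurable (fun=> a).
Proof. by split; exact: measurable_cst. Qed.

Lemma cmeasurableD f g : cmeasurable f -> cmeasurable g ->
  cmeasurable (fun w => f w + g w).
Proof.
move=> [f1 f2] [g1 g2]; split.
  by under eq_fun do rewrite ReD; exact: measurable_funD.
by under eq_fun do rewrite ImD; exact: measurable_funD.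
Qed.

Lemma cmeasurableM f g : cmeasurable f -> cmeasurable g ->
  cmeasurable (fun w => f w * g w).
Proof.
move=> [f1 f2] [g1 g2]; split.
  under eq_fun do rewrite ReM.
  by apply: measurable_funB; exact: measurable_funM.
under eq_fun do rewrite ImM.
by apply: measurable_funD; exact: measurable_funM.
Qed.

Lemma cmeasurable_mexp d (M : T -> 'M[C]_d) N (a : C) (B : 'M[C]_d) :
  entrywise cmeasurable M -> entrywise cmeasurable (fun w => mexp N (a *: M w + B)).
Proof.
exact: (entrywise_mexp cmeasurable_cst cmeasurableD cmeasurableM).
Qed.

Lemma measurable_Re_trace d (M : T -> 'M[C]_d) :
  entrywise cmeasurable M -> measurable_fun setT (fun w => complex.Re (\tr (M w))).
Proof. by move=> /(closed_trace cmeasurable_cst cmeasurableD)[]. Qed.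

Lemma cvg_series_exp_coeff (x : R) : series (exp_coeff x) @ \oo --> expR x.
Proof. exact: is_cvg_series_exp_coeff. Qed.

Lemma cvg_sum_series_exp_coeff d (x : 'I_d -> R) :
  (fun N => \sum_i series (exp_coeff (x i)) N) @ \oo --> \sum_i expR (x i).
Proof. by apply: cvg_big => //; [exact: add_continuous|move=> i _; exact: cvg_series_exp_coeff]. Qed.

(* [c <= gamma_max A] iff [1 <= \tr (exp (n (A - c)))] for all [n], which
   involves only limits of polynomials in the entries of [A]. *)
Lemma measurable_gamma_max_ge d (M : T -> 'M[C]_d) (c : R) : (0 < d)%N ->
  (forall w, M w \is hermsymmx) -> entrywise cmeasurable M ->
  measurable [set w | c <= gamma_max (M w)].
Proof.
move=> d0 hM mM.
pose u (n : nat) w (N : nat) : R :=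
  complex.Re (\tr (mexp N ((n%:R : R)%:C *: M w + (- (n%:R * c))%:C%:M))).
pose h n w : R := limn (u n w).
(* Diagonalization at each separate [w] only identifies the limit; measurability comes from the
   polynomials [u n w N]. *)
have hE w : exists x : 'I_d -> R,
  [/\ forall n, u n w @ \oo --> h n w, forall n, h n w = \sum_i expR (n%:R * (x i - c)),
   exists i, gamma_max (M w) = x i & forall i, x i <= gamma_max (M w)].
  have [U [x [U1 U2 ME gx xg]]] := gamma_max_spectral d0 (hM w).
  have cv n : u n w @ \oo --> \sum_i expR (n%:R * (x i - c)).
    have -> : u n w = fun N => \sum_i series (exp_coeff (n%:R * (x i - c))) N.
      apply/funext => N; rewrite /u (trace_mexp_spectral _ _ _ U1 U2 ME).
      by apply: eq_bigr => i _; rewrite mulrBr.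
    exact: cvg_sum_series_exp_coeff.
  have hn n : h n w = \sum_i expR (n%:R * (x i - c)) by apply/cvg_lim.
  by exists x; split=> // n; rewrite hn.
have mh n : measurable_fun setT (h n).
  apply: (@measurable_fun_cvg _ _ _ _ (fun N w => u n w N)).
    move=> N; exact/measurable_Re_trace/cmeasurable_mexp.
  by move=> w _; have [x [+ _ _ _]] := hE w; apply.
have -> : [set w | c <= gamma_max (M w)] =
    \bigcap_n (h n @^-1` [set` `[1, +oo[%R]).
  apply/seteqP; split=> w /=; have [x [_ hn [i gi] xg]] := hE w.
    move=> cg n _ /=; rewrite in_itv/= andbT hn (bigD1 i)//=.
    (* The top eigenvalue alone contributes at least 1. *)
    apply: (@le_trans _ _ (expR (n%:R * (x i - c)))).
      by rewrite -expR0 ler_expR mulr_ge0// subr_ge0 -gi.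
    by rewrite lerDl; apply: sumr_ge0 => ? _; exact: expR_ge0.
  move=> hw; rewrite leNgt; apply/negP => gc.
  pose e := c - gamma_max (M w).
  have e0 : 0 < e by rewrite subr_gt0.
  (* Each of the [d] terms is at most [exp (- n e)], and [d < n e < exp (n e)] makes their sum less
     than 1. *)
  pose n := (Num.truncn (d%:R / e)).+1.
  have ne : d%:R < n%:R * e by rewrite -ltr_pdivrMr// truncnS_gt.
  have := hw n I; rewrite /= in_itv/= andbT hn leNgt => /negP; apply.
  apply: (@le_lt_trans _ _ (\sum_(i < d) expR (- (n%:R * e)))).
    apply: ler_sum => j _; rewrite ler_expR -mulrN ler_wpM2l//.
    by rewrite /e opprB lerB.
  rewrite sumr_const card_ord -[_ *+ _]mulr_natl expRN.
  rewrite ltr_pdivrMr ?expR_gt0// mul1r.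
  by apply: lt_le_trans (expR_ge1Dx _); rewrite (lt_trans ne)// ltrDr.
apply: bigcap_measurable => // n _.
by rewrite -[X in measurable X]setTI; apply: mh => //; exact: measurable_itv.
Qed.

End Measurability.

(** * Integration against a sub-sigma-algebra *)

Section Integration.
Context (disp : measure_display) (T : measurableType disp) (R : realType).
Variable P : probability T R.
Implicit Types (f g D Z : T -> R) (E : set T).

Local Notation integ E f := (P.-integrable E (EFin \o f)).

Lemma integ_measurable f : integ setT f -> measurable_fun setT f.
Proof. by move=> /integrableP[/measurable_EFinP]. Qed.

Lemma integ_sub E f : measurable E -> integ setT f -> integ E f.
Proof. by move=> mE; exact: integrableS. Qed.

Lemma integZ E (c : R) f : measurable E -> integ E f -> integ E (fun w => c * f w).
Proof. by move=> mE; exact: (@integrableZl _ _ _ _ _ mE c (EFin \o f)). Qed.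

Lemma integD E f g : measurable E -> integ E f -> integ E g ->
  integ E (fun w => f w + g w).
Proof.
by move=> mE; exact: (@integrableD _ _ _ _ _ mE (EFin \o f) (EFin \o g)).
Qed.

Lemma integ_bounded f M : measurable_fun setT f -> (forall w, `|f w| <= M) ->
  integ setT f.
Proof.
move=> mf fM; apply: measurable_bounded_integrable => //.
  exact: le_lt_trans (probability_le1 P measurableT) (ltry _).
exists M; split; first exact: num_real.
by move=> x Mx w _; exact: le_trans (fM w) (ltW Mx).
Qed.

Lemma integ_mul_bounded Z D M : measurable_fun setT Z -> (forall w, `|Z w| <= M) ->
  integ setT D -> integ setT (fun w => Z w * D w).
Proof.
move=> mZ ZM iD; apply: (integrableMr measurableT mZ) iD.
exists M; split; first exact: num_real.
by move=> x Mx w _; exact: le_trans (ZM w) (ltW Mx).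
Qed.

Lemma ae_eq_Rintegral E f g : measurable E ->
  measurable_fun setT f -> measurable_fun setT g ->
  {ae P, forall w, E w -> f w = g w} ->
  \int[P]_(w in E) f w = \int[P]_(w in E) g w.
Proof.
move=> mE mf mg fg; congr fine; apply: ae_eq_integral => //.
- by apply/measurable_EFinP; exact: measurable_funTS.
- by apply/measurable_EFinP; exact: measurable_funTS.
- by apply: filterS fg => w h Ew; rewrite /= h.
Qed.

(** Serves to turn an almost sure bound [M] into a bound at every point, changing the function only
    on a null set. *)
Definition clamp M f w := Num.max (- M) (Num.min M (f w)).

Lemma clamp_le M f w : 0 <= M -> `|clamp M f w| <= M.
Proof.
move=> M0; rewrite ler_norml /clamp le_max lexx/= ge_max ge_min lexx/= andbT.
by rewrite (le_trans _ M0)// oppr_le0.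
Qed.

Lemma clamp_id M f w : `|f w| <= M -> clamp M f w = f w.
Proof. by rewrite ler_norml => /andP[fM Mf]; rewrite /clamp min_r// max_r. Qed.

Lemma measurable_clamp d' (T' : measurableType d') M (f : T' -> R) :
  measurable_fun setT f ->
  measurable_fun setT (fun w => Num.max (- M) (Num.min M (f w))).
Proof.
move=> mf; apply: measurable_maxr; first exact: measurable_cst.
by apply: measurable_minr => //; exact: measurable_cst.
Qed.

(** A negative bound would hold nowhere, against [P setT = 1]. *)
Lemma ae_bound_ge0 f M : {ae P, forall w, `|f w| <= M} -> 0 <= M.
Proof.
move=> h; rewrite leNgt; apply/negP => M0.
have : {ae P, forall w : T, False}.
  by apply: filterS h => w fM; have := le_lt_trans (le_trans (normr_ge0 _) fM) M0; rewrite ltxx.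
move=> h'; have : P setT = 0%E.
  by apply: measure_negligible => //; apply: negligibleS h' => w _ /=; case.
by rewrite probability_setT => /eqP; rewrite onee_eq0.
Qed.

Lemma integ_ae_bounded f M : measurable_fun setT f ->
  {ae P, forall w, `|f w| <= M} -> integ setT f.
Proof.
move=> mf fM; have M0 := ae_bound_ge0 fM.
apply/integrableP; split; first exact/measurable_EFinP.
apply: (@le_lt_trans _ _ (M%:E * P setT)%E).
  apply: integral_le_bound => //; first exact/measurable_EFinP.
  by apply: filterS fM => w fM _; rewrite lee_fin.
by rewrite probability_setT mule1 ltry.
Qed.

Lemma ae_le_Rintegral E f g : measurable E -> integ setT f -> integ setT g ->
  {ae P, forall w, E w -> f w <= g w} ->
  \int[P]_(w in E) f w <= \int[P]_(w in E) g w.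
Proof.
move=> mE fi gi fg.
have mf := integ_measurable fi; have mg := integ_measurable gi.
(* [h] dominates [f] everywhere and equals [g] almost surely on [E], which reduces the claim to
   pointwise monotonicity. *)
pose h w := Num.max (f w) (g w).
have mh : measurable_fun setT h by exact: measurable_maxr.
have hg : {ae P, forall w, E w -> h w = g w}.
  by apply: filterS fg => w fg Ew; rewrite /h max_r// fg.
have ih : integ setT h.
  apply: (@le_integrable _ _ _ _ _ measurableT _ (EFin \o (fun w => `|f w| + `|g w|))).
  - exact/measurable_EFinP.
  - move=> w _ /=; rewrite lee_fin /h [leRHS]ger0_norm ?addr_ge0//.
    by have [_|_] := leP (f w) (g w); [rewrite lerDr|rewrite lerDl]; exact: normr_ge0.
  - by apply: integD => //; exact: integrable_norm.
rewrite -(ae_eq_Rintegral mE mh mg hg); apply: le_Rintegral => //.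
- exact: integ_sub.
- exact: integ_sub.
- by move=> w _; rewrite le_max lexx.
Qed.

(** * Taking out a [G]-measurable factor *)

Section TakingOut.
Variables (G : set (set T)) (D : T -> R).
Hypotheses (sG : sigma_algebra setT G) (GT : G `<=` measurable).
Hypotheses (iD : integ setT D)
  (D0 : forall A, G A -> \int[P]_(w in A) D w = 0).

Let GE (A : set T) : measurable (A : set (g_sigma_algebraType G)) -> G A.
Proof. by rewrite measurable_g_measurableTypeE. Qed.

Lemma sub_measurable_fun Z :
  measurable_fun (setT : set (g_sigma_algebraType G)) (Z : g_sigma_algebraType G -> R) ->
  measurable_fun setT Z.
Proof.
move=> mZ _ B mB; apply: GT; apply: GE.
exact: (mZ measurableT).
Qed.

Lemma Rintegral_take_out_bounded Z M E :
  measurable_fun (setT : set (g_sigma_algebraType G)) (Z : g_sigma_algebraType G -> R) ->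
  (forall w, `|Z w| <= M) -> G E -> \int[P]_(w in E) (Z w * D w) = 0.
Proof.
move=> mZ ZM gE.
have mZT := sub_measurable_fun mZ.
have iZD := integ_mul_bounded mZT ZM iD.
have mE : measurable (E : set (g_sigma_algebraType G)).
  by rewrite measurable_g_measurableTypeE.
have iDn : integ setT (fun w => `|D w|) by exact: integrable_norm.
(* Cutting [E] along the level sets of [Z] with mesh [e] makes [Z] constant
   up to [e] on each piece, and constants times [D] integrate to 0. *)
have key e j : 0 < e -> let B := E `&` [set w | Z w < - M + j%:R * e] in
    `|\int[P]_(w in B) (Z w * D w)| <= e * \int[P]_(w in B) `|D w|.
  move=> e0; elim: j => [|j IH] /=.
    (* At [j = 0] the piece is empty, since [- M <= Z]. *)
    rewrite (_ : _ `&` _ = set0) ?Rintegral_set0 ?normr0 ?mulr0//.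
    rewrite -subset0 => w [_ /=]; rewrite mul0r addr0 ltNge => /negP; apply.
    by have := ZM w; rewrite ler_norml => /andP[].
  set B := E `&` [set w | Z w < - M + j%:R * e] in IH *.
  pose c := - M + j%:R * e.
  pose A := E `&` (Z @^-1` [set` `[c, c + e[%R]).
  have gB : G B.
    apply: GE; apply: measurableI => //.
    rewrite (_ : [set _ | _] = Z @^-1` [set` `]-oo, c[%R]).
      by rewrite -[X in measurable X]setTI; exact: (mZ measurableT _ (measurable_itv _)).
    by apply/seteqP; split => w /=; rewrite in_itv.
  have gA : G A.
    apply: GE; apply: measurableI => //.
    by rewrite -[X in measurable X]setTI; exact: (mZ measurableT _ (measurable_itv _)).
  have mA := GT gA; have mB := GT gB.
  have -> : E `&` [set w | Z w < - M + j.+1%:R * e] = B `|` A.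
    have jE : - M + j.+1%:R * e = c + e by rewrite /c -natr1; ring.
    rewrite jE; apply/seteqP; split => w /=.
      move=> [Ew Zw]; have [Zc|Zc] := ltP (Z w) c; [by left|right].
      by split => //=; rewrite in_itv/= Zc.
    move=> [[Ew /= Zc]|[Ew /=]].
      by split => //; rewrite (lt_le_trans Zc)// lerDl ltW.
    by rewrite in_itv/= => /andP[].
  have dBA : [disjoint B & A].
    apply/disj_setPS => w [[_ /= Zc] [_ /=]]; rewrite in_itv/= => /andP[cZ _].
    by move: Zc; rewrite ltNge cZ.
  have mBA : measurable (B `|` A) by exact: measurableU.
  rewrite !Rintegral_setU//; [|exact: integ_sub..].
  rewrite mulrDr; apply: le_trans (ler_normD _ _) _; apply: lerD => //.
  (* Subtracting [c] is free because [D] integrates to 0 on [A]; the remaining factor is at most [e]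
     there. *)
  have -> : \int[P]_(w in A) (Z w * D w) = \int[P]_(w in A) ((Z w - c) * D w).
    under [RHS]eq_Rintegral do rewrite mulrBl.
    rewrite RintegralB//; first last.
    - by apply: integZ => //; exact: integ_sub.
    - exact: integ_sub.
    by rewrite RintegralZl ?D0 ?mulr0 ?subr0//; exact: integ_sub.
  have iZc : integ setT (fun w => (Z w - c) * D w).
    apply: (@integ_mul_bounded _ _ (M + `|c|)) => //.
      by apply: measurable_funB => //; exact: measurable_cst.
    by move=> w; rewrite (le_trans (ler_normB _ _))// lerD.
  apply: le_trans (le_normr_Rintegral mA (integ_sub mA iZc)) _.
  rewrite -RintegralZl//; last exact: integ_sub.
  apply: le_Rintegral => //.
  - by apply: integ_sub => //; exact: integrable_norm.
  - by apply: integZ => //; exact: integ_sub.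
  - move=> w [_ /=]; rewrite in_itv/= => /andP[cZ Zc].
    rewrite normrM ler_wpM2r// ger0_norm ?subr_ge0//.
    by rewrite lerBlDl ltW.
apply/eqP; rewrite -normr_eq0 eq_le normr_ge0 andbT.
apply/ler_addgt0Pr => e e0; rewrite add0r.
pose I := \int[P]_(w in E) `|D w|.
have I0 : 0 <= I by apply: Rintegral_ge0.
(* The added 1 keeps the denominator positive, and [e' * I <= e]. *)
pose e' := e / (I + 1).
have I1 : 0 < I + 1 by rewrite ltr_pwDr.
have e'0 : 0 < e' by rewrite divr_gt0.
(* The level [- M + j e'] exceeds [M], so the cut recovers all of [E]. *)
pose j := (Num.truncn (2 * M / e')).+1.
have jM : 2 * M < j%:R * e' by rewrite -ltr_pdivrMr// truncnS_gt.
have := key e' j e'0.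
rewrite /= (_ : E `&` _ = E); last first.
  apply/setIidPl => w _ /=; have := ZM w; rewrite ler_norml => /andP[_ ZwM].
  by rewrite /=; lra.
move=> /le_trans; apply; rewrite -/I /e' mulrAC ler_pdivrMr//.
by rewrite ler_wpM2l ?ltW// ltrDl.
Qed.

(** [Z] is replaced by [clamp M Z], bounded everywhere, still [G]-measurable and almost surely equal
    to [Z]. *)
Lemma Rintegral_take_out Z M E :
  measurable_fun (setT : set (g_sigma_algebraType G)) (Z : g_sigma_algebraType G -> R) ->
  {ae P, forall w, `|Z w| <= M} -> G E ->
  integ setT (fun w => Z w * D w) /\ \int[P]_(w in E) (Z w * D w) = 0.
Proof.
move=> mZ ZM gE; have M0 := ae_bound_ge0 ZM.
have mZT := sub_measurable_fun mZ.
have mD := integ_measurable iD.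
have mc := measurable_clamp M mZ.
have mcT := sub_measurable_fun mc.
have h : {ae P, forall w : T, Z w * D w = clamp M Z w * D w}.
  by apply: filterS ZM => w ZM; rewrite clamp_id.
have ic := integ_mul_bounded mcT (fun w => clamp_le Z w M0) iD.
split.
  apply/integrableP; split; first by apply/measurable_EFinP; exact: measurable_funM.
  have /integrableP[_] := ic; congr (_ < _)%E.
  apply: ae_eq_integral => //.
  - by apply: measurableT_comp => //; apply/measurable_EFinP; exact: measurable_funM.
  - by apply: measurableT_comp => //; apply/measurable_EFinP; exact: measurable_funM.
  - by apply: filterS h => w /= -> _.
rewrite (@ae_eq_Rintegral _ _ (fun w => clamp M Z w * D w)); first last.
- by apply: filterS h.
- exact: measurable_funM.
- exact: measurable_funM.
- exact: GT.
exact: (Rintegral_take_out_bounded mc (fun w => clamp_le Z w M0) gE).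
Qed.

End TakingOut.
End Integration.

(** * Ville's inequality *)

Section Ville.
Context (disp : measure_display) (T : measurableType disp) (R : realType).
Variable P : probability T R.
Variables (F : nat -> set (set T)) (A : nat -> set T).
Hypothesis hF : filtration F.
Hypothesis FA : forall t, F t (A t).

Let pr (E : set T) : R := fine (P E).

(* No [A s] with [s < t] (strictly) has occurred. *)
Fixpoint avoid t := if t is s.+1 then avoid s `\` A s else setT.

Lemma sigma_measurableE G (X : set T) : sigma_algebra setT G ->
  measurable (X : set (g_sigma_algebraType G)) = G X.
Proof. by move=> sG; rewrite (measurable_g_measurableTypeE sG). Qed.

Lemma sigma_setD G (X Y : set T) : sigma_algebra setT G ->
  G X -> G Y -> G (X `\` Y).
Proof.
move=> sG; rewrite -!(sigma_measurableE _ sG) => mX mY; exact: measurableD.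
Qed.

Lemma sigma_setI G (X Y : set T) : sigma_algebra setT G ->
  G X -> G Y -> G (X `&` Y).
Proof.
move=> sG; rewrite -!(sigma_measurableE _ sG) => mX mY; exact: measurableI.
Qed.

(** [avoid t.+1] involves only [A 0] to [A t], so it is already known at time [t]; the one-step
    inequality can then be integrated over it. *)
Lemma avoid_filtration t : F t (avoid t) /\ F t (avoid t.+1).
Proof.
have [sF FT Fm] := hF.
have st u : F u (avoid u) -> F u (avoid u.+1).
  by move=> h; apply: sigma_setD.
suff h : F t (avoid t) by split => //; exact: st.
elim: t => [|t IH]; last exact: (Fm t t.+1 (leqnSn t)) (st _ IH).
have h0 := @measurableT _ (g_sigma_algebraType (F 0)).
by rewrite -(sigma_measurableE _ (sF 0%N)).
Qed.

Lemma avoid_measurable t : measurable (avoid t).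
Proof. by have [sF FT Fm] := hF; apply: (FT t); have [] := avoid_filtration t. Qed.

Lemma A_measurable t : measurable (A t).
Proof. by have [sF FT Fm] := hF; exact: FT. Qed.

Lemma avoid_split t : avoid t = (avoid t `&` A t) `|` avoid t.+1.
Proof. by rewrite /= setUIDK. Qed.

Lemma avoid_disj t : [disjoint avoid t `&` A t & avoid t.+1].
Proof. by apply/disj_setPS => w [[_ Aw] [_ /(_ Aw)]]. Qed.

(** The hits before [t] are split by the time [s] of the first one. *)
Lemma probability_hit t :
  pr (~` avoid t) = \sum_(s < t) pr (avoid s `&` A s).
Proof.
elim: t => [|t IH]; first by rewrite big_ord0 /= setCT /pr measure0.
rewrite big_ord_recr/= -IH /pr.
have mA := A_measurable t; have mB := avoid_measurable t.
rewrite -fineD; first last.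
- by apply: fin_num_measure; exact: measurableI.
- by apply: fin_num_measure; exact: measurableC.
rewrite -measureU.
- congr (fine (P _)); rewrite setCD [RHS]setUC; apply/seteqP; split => w /=;
  have [] := EM (avoid t w); tauto.
- exact: measurableC.
- exact: measurableI.
- by rewrite -subset0 => w [h [/h]].
Qed.

(** [g ^- t * L t] is a supermartingale up to time [n]. The quantity in [key], gains collected at
    first hits plus the mean over paths still running, starts at the mean of [L 0] and never
    increases. *)
Lemma ville_sum (L : nat -> T -> R) (g : R) (e : nat -> R) n : 0 < g ->
  (forall t, P.-integrable setT (EFin \o L t)) ->
  (forall t E, (t < n)%N -> F t E ->
     \int[P]_(w in E) L t.+1 w <= g * \int[P]_(w in E) L t w) ->
  (forall t E, (t < n)%N -> F t E -> E `<=` A t ->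
     e t * pr E <= \int[P]_(w in E) L t w) ->
  (forall E, F n E -> 0 <= \int[P]_(w in E) L n w) ->
  \sum_(s < n) g ^- s * e s * pr (avoid s `&` A s) <= \int[P]_(w in setT) L 0%N w.
Proof.
move=> g0 iL h1 h2 h3; have [sF FT Fm] := hF.
have gn k : 0 <= g ^- k by rewrite invr_ge0 exprn_ge0// ltW.
suff key t : (t <= n)%N -> \sum_(s < t) g ^- s * e s * pr (avoid s `&` A s) +
    g ^- t * \int[P]_(w in avoid t) L t w <= \int[P]_(w in setT) L 0%N w.
  apply: le_trans (key n (leqnn n)); rewrite lerDl mulr_ge0//.
  by apply: h3; have [] := avoid_filtration n.
elim: t => [_|t IH tn]; first by rewrite big_ord0 add0r expr0 invr1 mul1r.
apply: le_trans (IH (ltnW tn)); rewrite big_ord_recr/= -addrA lerD2l.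
have [Bt Bt1] := avoid_filtration t.
have Ht : F t (avoid t `&` A t) by apply: sigma_setI.
have -> : \int[P]_(w in avoid t) L t w =
    \int[P]_(w in avoid t `&` A t) L t w + \int[P]_(w in avoid t.+1) L t w.
  rewrite {1}(avoid_split t) Rintegral_setU//.
  - exact: FT Ht.
  - exact: avoid_measurable.
  - by rewrite -avoid_split; apply: integ_sub => //; exact: avoid_measurable.
  - exact: avoid_disj.
rewrite mulrDr -mulrA; apply: lerD.
  by rewrite ler_wpM2l// h2//; exact: subIsetr.
rewrite exprSr invfM -mulrA ler_wpM2l// mulrC ler_pdivrMr// mulrC.
exact: h1.
Qed.

End Ville.

(** * The one-step estimate for the trace potential *)

Section EssentiallyBounded.
Context (disp : measure_display) (T : measurableType disp) (R : realType).
Variable P : probability T R.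
Local Notation C := R[i].

Definition cbounded (f : T -> C) := exists M : R, {ae P, forall w, `|f w| <= M%:C}.

Lemma cbounded_cst (a : C) : cbounded (fun=> a).
Proof. by exists (complex.Re `|a|); apply: aeW => w; rewrite RRe_real ?normr_real. Qed.

Lemma cboundedD f g : cbounded f -> cbounded g -> cbounded (fun w => f w + g w).
Proof.
move=> [M hM] [N hN]; exists (M + N); apply: filterS2 hM hN => w fM gN.
by rewrite rmorphD; apply: le_trans (ler_normD _ _) (lerD fM gN).
Qed.

Lemma cboundedM f g : cbounded f -> cbounded g -> cbounded (fun w => f w * g w).
Proof.
move=> [M hM] [N hN]; exists (M * N); apply: filterS2 hM hN => w fM gN.
by rewrite rmorphM normrM ler_pM.
Qed.

Lemma normc_ge_Im (z : C) : `|complex.Im z|%:C <= `|z|.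
Proof. by rewrite normc_def lecR -sqrtr_sqr ler_wsqrtr// lerDr sqr_ge0. Qed.

Lemma cbounded_Re f : cbounded f -> exists M, {ae P, forall w, `|complex.Re (f w)| <= M}.
Proof.
move=> [M hM]; exists M; apply: filterS hM => w fM.
by rewrite -lecR (le_trans (normc_ge_Re _)).
Qed.

Lemma cbounded_Im f : cbounded f -> exists M, {ae P, forall w, `|complex.Im (f w)| <= M}.
Proof.
move=> [M hM]; exists M; apply: filterS hM => w fM.
by rewrite -lecR (le_trans (normc_ge_Im _)).
Qed.

End EssentiallyBounded.

Section Martingale.
Context (disp : measure_display) (T : measurableType disp) (R : realType).
Variables (P : probability T R) (d : nat) (F : nat -> set (set T)).
Variable Y : nat -> T -> 'M[R[i]]_d.
Hypothesis hY : hermitian_martingale P F Y.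
Hypothesis hY0 : forall w, Y 0%N w = 0.
Hypothesis hdY : forall t : nat, {ae P, forall w, opnorm (Y t.+1 w - Y t w) <= 1}.
Local Notation C := R[i].

Let hF : filtration F. Proof. by case: hY. Qed.
Let sF t : sigma_algebra setT (F t). Proof. by case: hF. Qed.
Let FT t : F t `<=` measurable. Proof. by case: hF. Qed.

Lemma martingale_herm t w : Y t w \is hermsymmx.
Proof. by case: hY. Qed.

Lemma martingale_cmeasurable t :
  entrywise (@cmeasurable _ (g_sigma_algebraType (F t)) R) (Y t).
Proof.
have [_ _ hc] := hY.
have mZ (Z : T -> R) : preimage_set_system setT Z measurable `<=` F t ->
    measurable_fun (setT : set (g_sigma_algebraType (F t))) (Z : g_sigma_algebraType (F t) -> R).
  by move=> h _ B mB; rewrite (sigma_measurableE _ (sF t)); apply: h; exists B.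
move=> i j; have [[_ _ h1 _] [_ _ h2 _]] := hc t i j.
by split; apply: mZ.
Qed.

Lemma martingale_integrable t i j :
  P.-integrable setT (EFin \o (fun w => complex.Re (Y t w i j))) /\
  P.-integrable setT (EFin \o (fun w => complex.Im (Y t w i j))).
Proof. by have [_ _ /(_ t i j)[[_ ? _ _] [_ ? _ _]]] := hY. Qed.

Lemma martingale_increment t i j E : F t E ->
  \int[P]_(w in E) complex.Re ((Y t.+1 w - Y t w) i j) = 0 /\
  \int[P]_(w in E) complex.Im ((Y t.+1 w - Y t w) i j) = 0.
Proof.
move=> FE; have [_ _ /(_ t i j)[[iX iZ _ h1] [iX' iZ' _ h2]]] := hY.
have mE := FT FE; split.
  under eq_Rintegral do rewrite !mxE ReB.
  rewrite RintegralB//; [|exact: integ_sub..].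
  by rewrite /Rintegral h1// subrr.
under eq_Rintegral do rewrite !mxE ImB.
rewrite RintegralB//; [|exact: integ_sub..].
by rewrite /Rintegral h2// subrr.
Qed.

(** Each of the [t] increments is at least [-1] in the semidefinite order. *)
Lemma ae_psd_shift t : {ae P, forall w, psd (Y t w + (t%:R : R)%:C%:M)}.
Proof.
elim: t => [|t IH].
  apply: aeW => w; rewrite hY0 add0r -scalemx1.
  exact: (psdZ (lexx 0) (@psd1 R d)).
apply: filterS2 IH (hdY t) => w h hD.
have hDh := hermsymmxB (martingale_herm t.+1 w) (martingale_herm t w).
have -> : Y t.+1 w + (t.+1%:R : R)%:C%:M =
   (Y t w + (t%:R : R)%:C%:M) + (1%:M + (Y t.+1 w - Y t w)).
  rewrite -natr1 rmorphD raddfD /=.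
  by apply/matrixP => i j; rewrite !mxE; ring.
exact: (psdD h (psd_1D hDh (opnorm_psd hDh hD))).
Qed.

Lemma martingale_cbounded t : entrywise (cbounded P) (Y t).
Proof.
move=> i j; elim: t => [|t IH].
  by under eq_fun do rewrite hY0 mxE; exact: cbounded_cst.
have -> : (fun w => Y t.+1 w i j) =
    (fun w => Y t w i j + (Y t.+1 w - Y t w) i j).
  by apply/funext => w; rewrite !mxE [RHS]addrC subrK.
(* A crude bound on the modulus of an entry whose real and imaginary parts are at most 1 in absolute
   value. *)
apply: cboundedD => //; exists 2.
apply: filterS (hdY t) => w hD; have [h1 h2] := opnorm_entry i j hD.
rewrite normc_def lecR -(ger0_norm (ler0n R 2)) -sqrtr_sqr ler_wsqrtr//.
rewrite -[X in X + _]real_normK ?num_real// -[X in _ + X]real_normK ?num_real//.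
have := normr_ge0 (complex.Re ((Y t.+1 w - Y t w) i j)).
have := normr_ge0 (complex.Im ((Y t.+1 w - Y t w) i j)).
nra.
Qed.

Section Horizon.
Variables (l : R) (n : nat).
Hypothesis l0 : 0 <= l.

(* The shift [l * n] makes [l Y_t + s D] positive semidefinite up to time [n],
   where the truncated exponentials of [mexp] are monotone. *)
Definition shifted t w : 'M[C]_d := l%:C *: Y t w + (l * n%:R)%:C%:M.

(** [N.+2] leaves room for the two differentiations in [trace_mexp_step]. *)
Definition potential N t w : R := complex.Re (\tr (mexp N.+2 (shifted t w))).

(** With [D] the increment, the matrix is [l (Y t + t) + s (1 + D) + (l n - l t - s)]. The last
    coefficient is nonnegative since [t + 1 <= n] and [s <= l]. *)
Lemma psd_shifted_line t w s : (t < n)%N -> 0 <= s <= l ->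
  opnorm (Y t.+1 w - Y t w) <= 1 -> psd (Y t w + (t%:R : R)%:C%:M) ->
  psd (shifted t w + s%:C *: (Y t.+1 w - Y t w)).
Proof.
move=> tn /andP[s0 sl] hD ht.
have hDh := hermsymmxB (martingale_herm t.+1 w) (martingale_herm t w).
have p1 := psdZ s0 (psd_1D hDh (opnorm_psd hDh hD)).
have p2 := psdZ l0 ht.
have c0 : 0 <= l * n%:R - l * t%:R - s.
  have : (t.+1%:R : R) <= n%:R by rewrite ler_nat.
  rewrite -natr1; nra.
have p3 := psdZ c0 (@psd1 R d).
have -> : shifted t w + s%:C *: (Y t.+1 w - Y t w) =
  (l%:C *: (Y t w + (t%:R : R)%:C%:M) + s%:C *: (1%:M + (Y t.+1 w - Y t w))) +
  (l * n%:R - l * t%:R - s)%:C *: 1%:M.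
  have -> : (l * n%:R - l * t%:R - s)%:C = l%:C * n%:R%:C - l%:C * t%:R%:C - s%:C.
    by rewrite !rmorphB !rmorphM.
  have lnE : (l * n%:R)%:C = l%:C * n%:R%:C by exact: rmorphM.
  rewrite /shifted lnE.
  move: (Y t w) (Y t.+1 w) (l%:C) (s%:C) (n%:R%:C) (t%:R%:C) => y z a b c e.
  apply/matrixP => i j; rewrite !mxE.
  by case: (i == j); rewrite ?mulr1n ?mulr0n; ring.
exact: (psdD (psdD p2 p1) p3).
Qed.

Lemma ae_psd_shifted t : (t <= n)%N -> {ae P, forall w, psd (shifted t w)}.
Proof.
move=> tn; apply: filterS (ae_psd_shift t) => w ht.
have p2 := psdZ l0 ht.
have c0 : 0 <= l * n%:R - l * t%:R.
  by rewrite subr_ge0 ler_wpM2l// ler_nat.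
have p3 := psdZ c0 (@psd1 R d).
have -> : shifted t w = l%:C *: (Y t w + (t%:R : R)%:C%:M) +
  (l * n%:R - l * t%:R)%:C *: 1%:M.
  apply/matrixP => i j; rewrite !mxE !rmorphB !rmorphM/=.
  by case: (i == j); rewrite ?mulr1n ?mulr0n; ring.
exact: (psdD p2 p3).
Qed.

Lemma mexp_shifted_cmeasurable N t :
  entrywise (@cmeasurable _ (g_sigma_algebraType (F t)) R)
    (fun w => mexp N (shifted t w)).
Proof. exact: cmeasurable_mexp (martingale_cmeasurable t). Qed.

Lemma mexp_shifted_cbounded N t :
  entrywise (cbounded P) (fun w => mexp N (shifted t w)).
Proof.
apply: entrywise_mexp (martingale_cbounded t);
  [exact: cbounded_cst|exact: cboundedD|exact: cboundedM].
Qed.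

Lemma potential_integrable N t : P.-integrable setT (EFin \o potential N t).
Proof.
have [M hM] := cbounded_Re (closed_trace (cbounded_cst P) (@cboundedD _ _ _ P)
  (mexp_shifted_cbounded N.+2 t)).
apply: (integ_ae_bounded _ hM).
apply: (sub_measurable_fun (sF t) (@FT t)).
exact: measurable_Re_trace (mexp_shifted_cmeasurable N.+2 t).
Qed.

(** Entrywise the trace is a combination of products of an almost surely bounded [F t]-measurable
    factor and a martingale increment, to which [Rintegral_take_out] applies. *)
Lemma increment_trace_null N t :
  P.-integrable setT (EFin \o (fun w =>
    complex.Re (\tr ((Y t.+1 w - Y t w) * mexp N (shifted t w))))) /\
  forall E, F t E -> \int[P]_(w in E)
    complex.Re (\tr ((Y t.+1 w - Y t w) * mexp N (shifted t w))) = 0.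
Proof.
pose null (f : T -> R) := P.-integrable setT (EFin \o f) /\
  forall E, F t E -> \int[P]_(w in E) f w = 0.
have nullD f g : null f -> null g -> null (fun w => f w + g w).
  move=> [f1 f2] [g1 g2]; split; first exact: integD.
  move=> E FE; have mE := FT FE.
  by rewrite RintegralD ?f2 ?g2 ?addr0//; exact: integ_sub.
have nullN f : null f -> null (fun w => - f w).
  move=> [f1 f2]; under eq_fun do rewrite -mulN1r; split; first exact: integZ.
  move=> E FE; have mE := FT FE.
  by rewrite RintegralZl ?f2 ?mulr0//; exact: integ_sub.
have null_sum (f : 'I_d -> T -> R) : (forall i, null (f i)) ->
    null (fun w => \sum_i f i w).
  move=> h; elim: (index_enum _) => [|i r IH].
    under eq_fun do rewrite big_nil; split; last first.
      by move=> E FE; rewrite Rintegral_cst ?mul0r//; exact: FT FE.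
    exact: integrable0.
  by under eq_fun do rewrite big_cons; exact: nullD.
have nullM (Z D : T -> R) :
    measurable_fun (setT : set (g_sigma_algebraType (F t))) (Z : g_sigma_algebraType (F t) -> R) ->
    (exists M, {ae P, forall w, `|Z w| <= M}) ->
    P.-integrable setT (EFin \o D) ->
    (forall E, F t E -> \int[P]_(w in E) D w = 0) -> null (fun w => Z w * D w).
  move=> mZ [M ZM] iD D0; split.
    have F_T : F t setT by rewrite -(sigma_measurableE _ (sF t)); exact: measurableT.
    by have [] := Rintegral_take_out (sF t) (@FT t) iD D0 mZ ZM F_T.
  by move=> E FE; have [] := Rintegral_take_out (sF t) (@FT t) iD D0 mZ ZM FE.
have traceE : (fun w => complex.Re (\tr ((Y t.+1 w - Y t w) * mexp N (shifted t w)))) =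
    fun w => \sum_i \sum_j
    (complex.Re (mexp N (shifted t w) j i) * complex.Re ((Y t.+1 w - Y t w) i j) +
    - (complex.Im (mexp N (shifted t w) j i) * complex.Im ((Y t.+1 w - Y t w) i j))).
  apply/funext => w; rewrite mxtrace_mulE Re_sum.
  apply: eq_bigr => i _; rewrite Re_sum; apply: eq_bigr => j _.
  by rewrite ReM; ring.
have inc i j := @martingale_increment t i j.
have iinc i j : P.-integrable setT (EFin \o (fun w => complex.Re ((Y t.+1 w - Y t w) i j))) /\
  P.-integrable setT (EFin \o (fun w => complex.Im ((Y t.+1 w - Y t w) i j))).
  have [a1 a2] := martingale_integrable t.+1 i j.
  have [b1 b2] := martingale_integrable t i j.
  split.
    under eq_fun do rewrite !mxE ReB -[X in _ - X]mul1r -mulNr.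
    by apply: integD => //; exact: integZ.
  under eq_fun do rewrite !mxE ImB -[X in _ - X]mul1r -mulNr.
  by apply: integD => //; exact: integZ.
rewrite traceE -/(null _).
apply: (null_sum _ _) => i; apply: (null_sum _ _) => j.
have [m1 m2] := mexp_shifted_cmeasurable N t j i.
have b := mexp_shifted_cbounded N t j i.
apply: nullD; [|apply: nullN]; apply: (nullM _ _) => //.
- exact: cbounded_Re b.
- by case: (iinc i j).
- by move=> E /(inc i j)[].
- exact: cbounded_Im b.
- by case: (iinc i j).
- by move=> E /(inc i j)[].
Qed.

Lemma potential_step N t E : (t < n)%N -> F t E ->
  \int[P]_(w in E) potential N t.+1 w <=
  (expR l + expR (- l)) / 2 * \int[P]_(w in E) potential N t w.
Proof.
move=> tn FE; have mE := FT FE.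
have [iG G0] := increment_trace_null N.+1 t.
set G := fun w => complex.Re _ in iG G0.
pose c := (expR l + expR (- l)) / 2.
pose s := (expR l - expR (- l)) / 2.
have iL := potential_integrable N.
(* The [sinh] term integrates to 0 over [E], so it may be added to match the pointwise bound. *)
have <- : \int[P]_(w in E) (c * potential N t w + s * G w) =
    c * \int[P]_(w in E) potential N t w.
  rewrite RintegralD//; [|by apply: integZ => //; exact: integ_sub..].
  by rewrite !RintegralZl ?G0 ?mulr0 ?addr0//; exact: integ_sub.
apply: ae_le_Rintegral => //.
  by apply: integD => //; exact: integZ.
apply: filterS2 (hdY t) (ae_psd_shift t) => w hD hw _.
have hDh := hermsymmxB (martingale_herm t.+1 w) (martingale_herm t w).
have -> : potential N t.+1 w = complex.Re (\tr (mexp N.+2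
    (shifted t w + l%:C *: (Y t.+1 w - Y t w)))).
  rewrite /potential; congr (complex.Re (\tr (mexp _ _))).
  by rewrite /shifted scalerBr [RHS]addrC addrA subrK.
have hline u (ul : 0 <= u <= l) := psd_shifted_line tn ul hD hw.
exact: (trace_mexp_step N l0 hline hDh (opnorm_psd hDh hD).2).
Qed.

End Horizon.
End Martingale.

(** * Line crossing *)

Section Crossing.
Context (disp : measure_display) (T : measurableType disp) (R : realType).
Variables (P : probability T R) (d : nat) (F : nat -> set (set T)).
Hypothesis d0 : (0 < d)%N.
Variable Y : nat -> T -> 'M[R[i]]_d.
Hypothesis hY : hermitian_martingale P F Y.
Hypothesis hY0 : forall w, Y 0%N w = 0.
Hypothesis hdY : forall t : nat, {ae P, forall w, opnorm (Y t.+1 w - Y t w) <= 1}.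
Variables (b m l : R).
Hypotheses (b0 : 0 <= b) (l0 : 0 <= l).

Let hF : filtration F. Proof. by case: hY. Qed.
Let sF t : sigma_algebra setT (F t). Proof. by case: hF. Qed.
Let FT t : F t `<=` measurable. Proof. by case: hF. Qed.
Let pr (E : set T) : R := fine (P E).

Definition crossing (t : nat) : set T :=
  [set w | m <= t%:R /\ b * t%:R <= gamma_max (Y t w)].

Lemma crossing_filtration t : F t (crossing t).
Proof.
rewrite -(sigma_measurableE _ (sF t)).
have [mt|tm] := leP m t%:R; last first.
  rewrite (_ : crossing t = set0)//; rewrite -subset0 => w [/le_lt_trans /(_ tm)].
  by rewrite ltxx.
have := @measurable_gamma_max_ge _ (g_sigma_algebraType (F t)) R d (Y t)
  (b * t%:R) d0 (martingale_herm hY t) (martingale_cmeasurable hY t).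
by congr measurable; apply/seteqP; split => w //= -[].
Qed.

Let g := (expR l + expR (- l)) / 2.

Let g0 : 0 < g. Proof. by rewrite divr_gt0// addr_gt0// expR_gt0. Qed.

(** Ville's inequality for the potential: [Y 0 = 0] gives the right-hand side, and a crossing at
    time [s] forces an eigenvalue of at least [b s], whence the weights on the left. *)
Lemma crossing_sum_trunc n N :
  \sum_(s < n) g ^- s * series (exp_coeff (l * (b * s%:R) + l * n%:R)) N.+2 *
    pr (avoid crossing s `&` crossing s) <=
  d%:R * series (exp_coeff (l * n%:R)) N.+2.
Proof.
have -> : d%:R * series (exp_coeff (l * n%:R)) N.+2 =
    \int[P]_(w in setT) potential Y l n N 0 w.
  under eq_Rintegral do rewrite /potential /shifted hY0 scaler0 add0r trace_mexp_scalar.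
  by rewrite Rintegral_cst// (congr1 fine (probability_setT P)) mulr1.
apply: (ville_sum hF crossing_filtration (L := potential Y l n N)
  (e := fun s => series (exp_coeff (l * (b * s%:R) + l * n%:R)) N.+2)) => //.
- exact: (potential_integrable hY hY0 hdY l n N).
- by move=> t E tn FE; exact: (potential_step hY hY0 hdY l0 N tn FE).
- move=> t E tn FE EA; have mE := FT FE.
  rewrite -Rintegral_cst//; apply: (@ae_le_Rintegral _ _ _ P E
     (fun=> series (exp_coeff (l * (b * t%:R) + l * n%:R)) N.+2)) => //.
  + apply: (@integ_bounded _ _ _ _ _ `|series (exp_coeff (l * (b * t%:R) + l * n%:R)) N.+2|) => //.
  + exact: (potential_integrable hY hY0 hdY l n N t).
  + apply: filterS (ae_psd_shifted hY hY0 hdY l0 (ltnW tn)) => w hw Ew.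
    have [_ bg] := EA _ Ew.
    apply: trace_mexp_gamma_max_ge => //; first exact: martingale_herm hY t w.
    by rewrite addr_ge0// !mulr_ge0.
- move=> E FE; have mE := FT FE.
  rewrite -[leLHS](mul0r (fine (P E))) -Rintegral_cst//.
  apply: (@ae_le_Rintegral _ _ _ P E (fun=> 0)) => //.
  + by apply: (@integ_bounded _ _ _ P (fun=> 0) 0) => // w; rewrite normr0.
  + exact: (potential_integrable hY hY0 hdY l n N n).
  + apply: filterS (ae_psd_shifted hY hY0 hdY l0 (leqnn n)) => w hw _.
    exact: trace_mexp_ge0.
Qed.

Let k := expR (l * b) / g.
Hypothesis k1 : 1 <= k.

(** As [N] tends to infinity the series become exponentials, and the factor [exp (l n)] due to the
    shift cancels. *)
Lemma crossing_sum n :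
  \sum_(s < n) k ^+ s * pr (avoid crossing s `&` crossing s) <= d%:R.
Proof.
have cv (x : R) : (fun N => series (exp_coeff x) N.+2) @ \oo --> expR x.
  exact: (cvg_comp (addn 2) (series (exp_coeff x)) (@cvg_addnl 2)
    (@cvg_series_exp_coeff R x)).
have : \sum_(s < n) g ^- s * expR (l * (b * s%:R) + l * n%:R) *
    pr (avoid crossing s `&` crossing s) <= d%:R * expR (l * n%:R).
  have c1 : (fun N => \sum_(s < n) g ^- s *
      series (exp_coeff (l * (b * s%:R) + l * n%:R)) N.+2 *
      pr (avoid crossing s `&` crossing s)) @ \oo -->
      \sum_(s < n) g ^- s * expR (l * (b * s%:R) + l * n%:R) *
      pr (avoid crossing s `&` crossing s).
    apply: cvg_big => //; first exact: add_continuous.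
    move=> s _; apply: cvgM; last exact: cvg_cst.
    by apply: cvgM; [exact: cvg_cst|exact: cv].
  have c2 : (fun N => d%:R * series (exp_coeff (l * n%:R)) N.+2) @ \oo -->
      d%:R * expR (l * n%:R).
    by apply: cvgM; [exact: cvg_cst|exact: cv].
  apply: (ler_cvg_to c1 c2); apply: nearW => N; exact: crossing_sum_trunc.
move=> h; rewrite -(ler_pM2r (expR_gt0 (l * n%:R))); apply: le_trans h.
rewrite mulr_suml le_eqVlt; apply/orP; left; apply/eqP; apply: eq_bigr => s _.
rewrite expRD [l * (b * _)]mulrA [expR (l * b * _)]expRM_natr exprMn exprVn; ring.
Qed.

(** [crossing s] is empty for [s < m], and [k ^ s >= k ^ m] for [s >= m] since [k >= 1]. *)
Lemma crossing_before n : k `^ m * pr (~` avoid crossing n) <= d%:R.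
Proof.
rewrite /pr (probability_hit P hF crossing_filtration) mulr_sumr.
apply: le_trans (crossing_sum n); apply: ler_sum => s _.
have [ms|sm] := leP m s%:R.
  apply: ler_wpM2r; first by rewrite fine_ge0.
  by rewrite -powR_mulrn ?(le_trans ler01)// ler_powR.
have -> : avoid crossing s `&` crossing s = set0.
  by rewrite -subset0 => w [_ [/le_lt_trans /(_ sm)]]; rewrite ltxx.
by rewrite /pr measure0/= !mulr0.
Qed.

(** Continuity from below: the complements of [avoid crossing n] increase to the union of the
    crossings. *)
Lemma crossing_bound : (P (\bigcup_t crossing t) <= (d%:R * k `^ (- m))%:E)%E.
Proof.
have k0 : 0 < k by exact: lt_le_trans k1.
have mavoid n : measurable (~` avoid crossing n).
  by apply: measurableC; exact: (avoid_measurable hF crossing_filtration).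
have -> : \bigcup_t crossing t = \bigcup_n ~` avoid crossing n.
  apply/seteqP; split => w.
    by move=> [t _ ct]; exists t.+1 => // -[_ /(_ ct)].
  move=> [n _]; elim: n => [/(_ I)//|n IH] /= h.
  have [av|nav] := EM (avoid crossing n w); last exact: IH.
  have [c|nc] := EM (crossing n w); first by exists n.
  by exfalso; apply: h.
have nd : nondecreasing_seq (fun n => ~` avoid crossing n).
  apply/nondecreasing_seqP => n; apply/subsetPset => w /= h [av _]; exact: h.
have cv := @nondecreasing_cvg_mu _ _ _ P _ mavoid (bigcup_measurable (fun n _ => mavoid n)) nd.
rewrite -(cvg_lim _ cv)//; apply: lime_le; first by apply/cvg_ex; eexists; exact: cv.
apply: nearW => n /=; rewrite -[leLHS]fineK ?fin_num_measure// lee_fin.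
by rewrite powRN ler_pdivlMr ?powR_gt0// mulrC; exact: crossing_before.
Qed.

End Crossing.

(** * Choice of the parameter [l] *)

Theorem corollary5 (disp : measure_display) (T : measurableType disp)
  (R : realType) (P : probability T R) (d : nat) (hd : (0 < d)%N)
  (F : nat -> set (set T)) (Y : nat -> T -> 'M[R[i]]_d)
  (hY : hermitian_martingale P F Y)
  (hY0 : forall w, Y 0%N w = 0)
  (hdY : forall t : nat, (1 <= t)%N ->
     {ae P, forall w, opnorm (Y t w - Y t.-1 w) <= 1})
  (b m : R) (hb0 : 0 <= b) (hb1 : b <= 1) (hm : 1 <= m) :
  (P [set w | exists t : nat,
        [/\ (1 <= t)%N, (m <= t%:R)%R & (b * t%:R <= gamma_max (Y t w))%R]]
   <= (d%:R * ((1 + b) `^ (1 + b) * (1 - b) `^ (1 - b)) `^ (- (m / 2)))%:E)%E.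
Proof.
have hD t := hdY t.+1 (ltn0Sn t).
have -> : [set w | exists t : nat,
    [/\ (1 <= t)%N, (m <= t%:R)%R & (b * t%:R <= gamma_max (Y t w))%R]] =
    \bigcup_t crossing Y b m t.
  apply/seteqP; split => w [t]; first by move=> [_ mt bt]; exists t.
  move=> _ [mt bt]; exists t; split => //.
  (* Time 0 is excluded by [1 <= m <= t]. *)
  by rewrite -(ler_nat R) (le_trans hm).
have bound := crossing_bound hd hY hY0 hD m hb0.
set S := \bigcup_t _ in bound *.
(* No finite [l] has [tanh l = 1], so [b = 1] is reached as a limit. *)
move: hb1; rewrite le_eqVlt => /orP[/eqP b1|b1].
  pose p := fine (P S).
  have mS : measurable S.
    apply: bigcup_measurable => t _; have [_ FT _] : filtration F by case: hY.
    apply: (FT t); exact: (crossing_filtration hd hY).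
  have pE : P S = p%:E by rewrite fineK// fin_num_measure.
  have p1 : p <= 1 by rewrite -lee_fin -pE probability_le1.
  (* The factor in [1 - b] is now 0 to the power 0, which equals 1. *)
  rewrite pE lee_fin b1 subrr powRr0 mulr1.
  set K := d%:R * _.
  have K0 : 0 <= K by rewrite mulr_ge0// powR_ge0.
  have KE : K = d%:R * expR (- (m * ln 2)).
    rewrite /K -powRrM (_ : (1 + 1) = 2 :> R)// /powR pnatr_eq0/=.
    by congr (_ * expR _); field.
  apply/ler_addgt0Pr => e e0.
  (* Chosen so that [exp (- 2 l) = v] with [v = 1 / (1 + m / e)]. Then [k = 2 / (1 + v)] and
     [k ^ (- m) <= 2 ^ (- m) exp (m v)], where [m v <= e]. *)
  pose l := ln (1 + m / e) / 2.
  have me0 : 0 < m / e by rewrite divr_gt0// (lt_le_trans ltr01).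
  have l0 : 0 <= l by rewrite divr_ge0// ln_ge0// lerDl ltW.
  have El : expR (- l) = expR l * (1 + m / e)^-1.
    have -> : - l = l + - ln (1 + m / e) by rewrite /l; field.
    by rewrite expRD expRN lnK// posrE addr_gt0.
  have kE : expR (l * b) / ((expR l + expR (- l)) / 2) = 2 / (1 + (1 + m / e)^-1).
    have le0 : expR l != 0 by rewrite gt_eqF// expR_gt0.
    have i0 : 1 + (1 + m / e)^-1 != 0.
      by rewrite gt_eqF// addr_gt0// invr_gt0 addr_gt0.
    rewrite b1 mulr1 El -[X in X + _]mulr1 -mulrDr.
    move: (1 + m / e)^-1 i0 => x i0; field; by rewrite i0.
  have v0 : 0 < (1 + m / e)^-1 by rewrite invr_gt0 addr_gt0.
  have v1 : (1 + m / e)^-1 <= 1 by rewrite invf_le1 ?lerDl ?addr_gt0// ltW.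
  have := bound l l0; rewrite kE pE lee_fin.
  have -> : 1 <= 2 / (1 + (1 + m / e)^-1).
    by rewrite ler_pdivlMr ?addr_gt0// mul1r; lra.
  move=> /(_ isT) h.
  have {h} : p <= K * expR e.
    apply: (le_trans h); rewrite KE -mulrA -expRD ler_wpM2l//.
    rewrite /powR gt_eqF ?divr_gt0 ?addr_gt0// ler_expR.
    rewrite ln_div ?posrE ?addr_gt0//.
    have : ln (1 + (1 + m / e)^-1) <= (1 + m / e)^-1.
      by apply: le_ln1Dx; rewrite (lt_trans _ v0)// ltrN10.
    have : m * (1 + m / e)^-1 <= e.
      rewrite ler_pdivrMr ?addr_gt0// mulrDr mulr1 mulrC divfK ?gt_eqF//.
      by rewrite lerDr ltW.
    nra.
  move=> h.
  (* From [p (1 - e) <= p exp (- e) <= K] and [p <= 1] follows [p <= K + e]. *)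
  have : p * expR (- e) <= K by rewrite expRN ler_pdivrMr ?expR_gt0.
  have : 1 - e <= expR (- e) by exact: expR_ge1Dx.
  have : 0 <= p by rewrite fine_ge0.
  nra.
(* The solution of [tanh l = b] is [l = (x - y) / 2]. *)
pose x := ln (1 + b); pose y := ln (1 - b).
have pb : 0 < 1 + b by rewrite ltr_pwDl.
have nb : 0 < 1 - b by rewrite subr_gt0.
have Ex : expR x = 1 + b by rewrite lnK.
have Ey : expR y = 1 - b by rewrite lnK.
have l0 : 0 <= (x - y) / 2.
  by rewrite divr_ge0// subr_ge0 ler_ln ?posrE//; lra.
(* This gives [k >= 1]: the bound [z ln z >= z - 1] at [1 + b] and [1 - b] yields [b] and [- b],
   which cancel. *)
have q0 : 0 <= ((1 + b) * x + (1 - b) * y) / 2.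
  rewrite divr_ge0//.
  have h (z : R) : 0 < z -> z - 1 <= z * ln z.
    move=> z0; have := expR_ge1Dx (- ln z); rewrite expRN lnK ?posrE// => hz.
    have : z * (1 - ln z) <= z * z^-1 by rewrite ler_wpM2l// ltW.
    by rewrite divff ?gt_eqF//; lra.
  by have := h _ pb; have := h _ nb; rewrite -/x -/y; lra.
have kE : expR ((x - y) / 2 * b) / ((expR ((x - y) / 2) + expR (- ((x - y) / 2))) / 2)
    = expR (((1 + b) * x + (1 - b) * y) / 2).
  (* Evaluates [cosh l] by [exp x + exp y = 2]; [k] is then the square root of the bracket in the
     theorem. *)
  have -> : (expR ((x - y) / 2) + expR (- ((x - y) / 2))) / 2 = expR (- ((x + y) / 2)).
    have -> : expR ((x - y) / 2) = expR x * expR (- ((x + y) / 2)).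
      by rewrite -expRD; congr expR; field.
    have -> : expR (- ((x - y) / 2)) = expR y * expR (- ((x + y) / 2)).
      by rewrite -expRD; congr expR; field.
    by rewrite Ex Ey; field.
  by rewrite -expRN -expRD; congr expR; field.
have e1 : 1 <= expR (((1 + b) * x + (1 - b) * y) / 2) by rewrite -[leLHS]expR0 ler_expR.
have := bound _ l0; rewrite kE => /(_ e1).
move=> /le_trans; apply; rewrite lee_fin le_eqVlt; apply/orP; left; apply/eqP.
congr (_ * _).
have -> : (1 + b) `^ (1 + b) = expR (x * (1 + b)) by rewrite expRM Ex.
have -> : (1 - b) `^ (1 - b) = expR (y * (1 - b)) by rewrite expRM Ey.
by rewrite -expRD -!expRM; congr expR; field.
Qed.
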